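(* Let $f:X\to Y$ be a closed homologically $UV^n(G)$ surjection between paracompact spaces. Then for every open cover $\mathcal U$ of $Y$ there exists an open cover $\mathcal V$ of $Y$ with the following property: if $\varphi:S(A;G)\to S(X;G)$ is a continuous correct $f^{-1}(\mathcal V)$-small chain morphism, where $A$ is a closed subset of a metric space $M$ with $\dim M\le n+1$, then there exist an open set $W\subset M$ containing $A$, an open cover $\alpha$ of $W$ and a correct chain morphism $\phi:S(W,\alpha;G)\to S(X;G)$ such that $\phi|S(A,\alpha;G)$ and $\varphi|S(A,\alpha;G)$ are $f^{-1}(\mathcal U)$-close.
   Context: Conventions: all spaces are paracompact, maps are continuous; $G$ is a commutative ring with unit; $n\ge0$ is an integer; $\dim$ is covering dimension; $H_k(\cdot;G)$ is singular homology, reduced in dimension $0$. A closed set $A\subset X$ is homologically $UV^n(G)$ if every neighborhood $U$ of $A$ in $X$ contains another neighborhood $V$ of $A$ such that the inclusion induces trivial homomorphisms $H_k(V;G)\to H_k(U;G)$ for all $k\le n$. A surjective map $f:X\to Y$ is homologically $UV^n(G)$ if all fibres $f^{-1}(y)$, $y\in Y$, are homologically $UV^n(G)$-subsets of $X$. For an open cover $\mathcal V$ of $Y$, $f^{-1}(\mathcal V)=\{f^{-1}(V):V\in\mathcal V\}$. A chain morphism is a sequence of homomorphisms of $G$-modules (degree by degree) commuting with the boundaries and, in degree $0$, with the augmentations. $S(X;G)$ is the singular chain complex of $X$. For an open cover $\alpha$ of $W$, $S(W,\alpha;G)$ is the subcomplex of $S(W;G)$ generated by all singular simplexes whose carrier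 lies in some element of $\alpha$; for $A\subset W$, $S(A,\alpha;G)$ is generated by all singular simplexes of $A$ whose carrier lies in some element of $\alpha$. The carrier of a singular simplex $\sigma:\triangle^k\to X$ is $|\sigma|=\sigma(\triangle^k)$; for a chain $c=\sum_i g_i\sigma_i$ (irreducible representation) $|c|=\bigcup_i|\sigma_i|$, and $|0|=\varnothing$. A face of a singular simplex $\sigma$ defined on $\triangle^k$ is the restriction of $\sigma$ to a face of $\triangle^k$. A chain morphism from a singular complex (or subcomplex spanned by singular simplexes) to $S(X;G)$ is correct if it sends every singular $0$-simplex of its domain to a singular $0$-simplex of $X$. For an open cover $\mathcal W$ of $X$, chain morphisms $\varphi,\psi$ with the same such domain are $\mathcal W$-close if for each singular simplex $\sigma$ of the domain there is $W_\sigma\in\mathcal W$ with $|\varphi(\tau)|\cup|\psi(\tau)|\subset W_\sigma$ for all faces $\tau$ of $\sigma$; $\varphi$ is $\mathcal W$-small if for each singular simplex $\sigma$ of the domain there is $W_\sigma\in\mathcal W$ with $|\varphi(\tau)|\subset W_\sigma$ for all faces $\tau$ of $\sigma$. A chain morphism $\varphi:S(Z;G)\to S(X;G)$ is continuous if for every $z\in Z$ and any neighborhood $U$ of $|\varphi(z)|$ in $X$ there is a neighborhood $V$ of $z$ in $Z$ with $|\varphi(z')|\subset U$ for all $z'\in V$ (points of $Z$ being identified with singular $0$-simplexes of $Z$). *)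

(* Defs.v *)
From HB Require Import structures.
From mathcomp Require Import all_boot all_order all_algebra.
From mathcomp Require Import ring_quotient freeg zify.
From mathcomp Require Import all_classical all_reals all_analysis.

Set Implicit Arguments.
Unset Strict Implicit.
Unset Printing Implicit Defensive.

Import Order.TTheory GRing.Theory Num.Theory.
Import numFieldNormedType.Exports.

Local Open Scope classical_set_scope.
Local Open Scope ring_scope.

Definition open_cover (T : topologicalType) (W : set T) (U : set (set T)) : Prop :=
  (forall B, U B -> open B /\ B `<=` W) /\ W `<=` \bigcup_(B in U) B.

Definition refines (T : Type) (V U : set (set T)) : Prop :=
  forall B, V B -> exists2 C, U C & B `<=` C.

Definition locally_finite (T : topologicalType) (V : set (set T)) : Prop :=
  forall x : T, exists2 N, nbhs x N & finite_set [set B | V B /\ B `&` N !=set0].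

(* The Hausdorff axiom is part of the definition of a paracompact space. *)
Definition paracompact (T : topologicalType) : Prop :=
  hausdorff_space T /\
  forall U : set (set T), open_cover setT U ->
    exists V, [/\ open_cover setT V, refines V U & locally_finite V].

(* [order_le V m]: the order of V is at most m, i.e. no point lies in more
   than m+1 members of V. *)
Definition order_le (T : Type) (V : set (set T)) (m : nat) : Prop :=
  forall x : T, ([set B | V B /\ B x] #<= `I_m.+1)%card.

Definition dim_le (T : topologicalType) (m : nat) : Prop :=
  forall U : set (set T), open_cover setT U -> finite_set U ->
    exists V, [/\ open_cover setT V, finite_set V, refines V U & order_le V m].

Definition preimage_cover (S T : Type) (f : S -> T) (V : set (set T)) :
  set (set S) := [set f @^-1` B | B in V].

Definition closed_map (S T : topologicalType) (f : S -> T) : Prop :=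
  forall C : set S, closed C -> closed (f @` C).

Section Simplexes.
Variable R : realType.

Definition std_simplex (k : nat) : set 'rV[R]_k.+1 :=
  [set x | (forall i, 0 <= x 0 i) /\ \sum_i x 0 i = 1].
Arguments std_simplex : clear implicits.

(* The affine map sending the vertex e_l to the vertex e_(theta l). *)
Definition affine_mx j k (theta : 'I_j.+1 -> 'I_k.+1) (x : 'rV[R]_j.+1) :
  'rV[R]_k.+1 := \row_i \sum_(l | theta l == i) x 0 l.

Lemma affine_mx_std j k (theta : 'I_j.+1 -> 'I_k.+1) (x : std_simplex j) :
  affine_mx theta (set_val x) \in std_simplex k.
Proof.
have [x0 x1] := set_mem (valP x); apply/mem_set; split=> [i|].
  by rewrite mxE sumr_ge0.
under eq_bigr do rewrite mxE.
by rewrite -[RHS]x1 (partition_big theta predT).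
Qed.

Definition affine j k (theta : 'I_j.+1 -> 'I_k.+1) (x : std_simplex j) :
  std_simplex k := SigSub (affine_mx_std theta x).

Lemma affine_continuous j k (theta : 'I_j.+1 -> 'I_k.+1) :
  continuous (affine theta).
Proof.
apply: continuous_comp_initial => x A [P nP PA].
have cv (l : 'I_j.+1) :
    continuous (fun y : std_simplex j => (set_val y : 'rV[R]_j.+1) 0 l).
  move=> y; apply: (@continuous_comp _ _ _ (set_val : std_simplex j -> 'rV[R]_j.+1)
    (fun v => v 0 l)); first exact: initial_continuous.
  exact: coord_continuous.
have cs i : continuous (fun y : std_simplex j =>
    \sum_(l | theta l == i) (set_val y : 'rV[R]_j.+1) 0 l).
  by apply: (continuous_big add_continuous) => l _; exact: cv.
have nPi (i : 'I_k.+1) : \forall y \near nbhs x,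
    P 0 i (affine_mx theta (set_val y) 0 i).
  have := nP 0 i; rewrite /= mxE => /(cs i x) nPs.
  apply: (@filterS _ _ (nbhs_filter x) _ _ _ nPs) => y /=.
  by rewrite mxE.
have nPall := @filter_forall _ _ _ _ (nbhs_filter x) nPi.
apply: (@filterS _ _ (nbhs_filter x) _ _ _ nPall) => y Py /=.
by apply: PA => a i; rewrite !ord1; exact: Py.
Qed.

Record sing (T : topologicalType) (k : nat) := Sing {
  sing_fun :> std_simplex k -> T;
  sing_continuous : continuous sing_fun }.

HB.instance Definition _ T k := gen_eqMixin (sing T k).
HB.instance Definition _ T k := gen_choiceMixin (sing T k).

Variable T : topologicalType.

Lemma face_continuous j k (theta : 'I_j.+1 -> 'I_k.+1) (s : sing T k) :
  continuous (s \o affine theta).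
Proof.
by move=> x; apply: continuous_comp; [exact: affine_continuous
  | exact: sing_continuous].
Qed.

Definition face j k (theta : 'I_j.+1 -> 'I_k.+1) (s : sing T k) : sing T j :=
  Sing (@face_continuous j k theta s).

Definition increasing j k (theta : 'I_j.+1 -> 'I_k.+1) : Prop :=
  {homo theta : a b / (a < b)%N}.

Definition is_face j k (t : sing T j) (s : sing T k) : Prop :=
  exists2 theta, increasing theta & t = face theta s.

Lemma lift_increasing k (i : 'I_k.+2) : increasing (fintype.lift i).
Proof.
by move=> a b ab; rewrite /= /bump; case: (leqP i a); case: (leqP i b); lia.
Qed.

Definition scarrier k (s : sing T k) : set T := range s.

Lemma face_carrier j k (t : sing T j) (s : sing T k) :
  is_face t s -> scarrier t `<=` scarrier s.
Proof. by move=> [theta _ ->] _ [x _ <-]; exists (affine theta x). Qed.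

Definition point_sing (x : T) : sing T 0 := Sing (@cst_continuous _ T x).

Lemma point_carrier (x : T) : scarrier (point_sing x) `<=` [set x].
Proof. by move=> _ [? _ <-]. Qed.

(* A face-closed family of singular simplexes; it is the basis of a subcomplex
   of the singular complex of T. *)
Record simp_family := SimpFamily {
  family_set :> forall k, set (sing T k);
  family_face : forall j k (t : sing T j) (s : sing T k),
    is_face t s -> family_set s -> family_set t }.

Definition subfamily (D E : simp_family) : Prop := forall k, D k `<=` E k.

(* Basis of S(A): continuous maps into the subspace A are the continuous maps
   into T whose image is in A. *)
Program Definition sing_in (A : set T) : simp_family :=
  @SimpFamily (fun k => [set s | scarrier s `<=` A]) _.
Next Obligation.
by move=> A j k t s /face_carrier ts sA; exact: subset_trans ts sA.
Qed.

(* Basis of S(A, alpha). *)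
Program Definition sing_small (A : set T) (alpha : set (set T)) : simp_family :=
  @SimpFamily (fun k => [set s | scarrier s `<=` A /\
    exists2 B, alpha B & scarrier s `<=` B]) _.
Next Obligation.
move=> A alpha j k t s /face_carrier ts [sA [B aB sB]].
by split; [|exists B]=> //; exact: subset_trans ts _.
Qed.

Lemma sing_in_sub (A B : set T) : A `<=` B -> subfamily (sing_in A) (sing_in B).
Proof. by move=> AB k s sA; exact: subset_trans sA AB. Qed.

Lemma sing_small_in (A : set T) alpha : subfamily (sing_small A alpha) (sing_in A).
Proof. by move=> k s []. Qed.

Lemma sing_small_sub (A B : set T) alpha :
  A `<=` B -> subfamily (sing_small A alpha) (sing_small B alpha).
Proof. by move=> AB k s [sA ?]; split=> //; exact: subset_trans sA AB. Qed.

End Simplexes.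

Arguments family_set {R T} D k _ : rename.
Arguments sing_in R {T} A.
Arguments sing_small R {T} A alpha.

Notation chain G D k := {freeg (set_type (family_set D k)) / G}.

Section LinearExtension.
Variables (G : comNzRingType) (K : choiceType) (V : lmodType G) (h : K -> V).

(* The linear extension of a map defined on the basis K. *)
Definition lin_ext (c : {freeg K / G}) : V := fglift h c.

Lemma lin_ext_is_linear : linear lin_ext.
Proof.
move=> a c d; rewrite /lin_ext.
have additive_h := @lift_is_additive G K V h.
have h0 : fglift h 0 = 0 by rewrite -(subrr (0 : {freeg K / G})) additive_h subrr.
have hD x y : fglift h (x + y) = fglift h x + fglift h y.
  by rewrite -[y in LHS]opprK additive_h -[- y]sub0r additive_h h0 sub0r opprK.
have hS (s : seq K) (F : K -> {freeg K / G}) :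
    fglift h (\sum_(x <- s) F x) = \sum_(x <- s) fglift h (F x).
  by elim: s => [|x s IH]; rewrite ?big_nil // !big_cons hD IH.
rewrite hD; congr (_ + _).
rewrite -[in RHS](freeg_sumE c) [a *: c]/(fgscale a c) /fgscale !hS scaler_sumr.
by apply: eq_bigr => x _; rewrite !liftU scalerA.
Qed.

HB.instance Definition _ :=
  GRing.isLinear.Build G {freeg K / G} V *:%R lin_ext lin_ext_is_linear.

Lemma lin_extU (x : K) : lin_ext << x >> = h x.
Proof. by rewrite /lin_ext liftU scale1r. Qed.

Lemma eq_on_basis (u v : {linear {freeg K / G} -> V}) :
  (forall x : K, u << x >> = v << x >>) -> u =1 v.
Proof.
move=> uv c; rewrite -(freeg_sumE c) !linear_sum; apply: eq_bigr => x _.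
have -> : << coeff x c *g x >> = coeff x c *: << x >> :> {freeg K / G}.
  apply/eqP/freeg_eqP => y.
  by rewrite coeffZ !coeffU mul1r.
by rewrite !linearZ /= uv.
Qed.

End LinearExtension.

Section Chains.
Variables (R : realType) (G : comNzRingType).

Section OneFamily.
Variables (T : topologicalType) (D : simp_family R T).

Definition gen k (s : D k) : chain G D k := << s >>.

Lemma face_in_family j k (theta : 'I_j.+1 -> 'I_k.+1) (s : D k) :
  increasing theta -> face theta (set_val s) \in D j.
Proof.
move=> incr; apply/mem_set; apply: family_face (set_valP s).
by exists theta.
Qed.

Definition dface k (i : 'I_k.+2) (s : D k.+1) : D k :=
  SigSub (face_in_family s (@lift_increasing k i)).

Definition bd k : chain G D k.+1 -> chain G D k :=
  lin_ext (fun s : D k.+1 => \sum_(i < k.+2) (-1) ^+ i *: gen (dface i s)).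

HB.instance Definition _ k := GRing.Linear.on (@bd k).

Definition aug : chain G D 0 -> G^o := lin_ext (fun _ : D 0 => 1 : G^o).

HB.instance Definition _ := GRing.Linear.on aug.

Definition carrier k (c : chain G D k) : set T :=
  \bigcup_(s in [set s | s \in dom c]) scarrier (set_val s).

(* In degree 0 the boundary operator is the augmentation. *)
Definition is_cycle k : pred (chain G D k) :=
  match k with
  | 0 => fun c => aug c == 0
  | k'.+1 => fun c => bd c == 0
  end.

Lemma is_cycle_zmod_closed k : zmod_closed (@is_cycle k).
Proof.
case: k => [|k]; split; rewrite ?unfold_in /= ?linear0 //.
  by move=> c d /eqP hc /eqP hd; apply/eqP; rewrite linearB /= hc hd subrr.
by move=> c d /eqP hc /eqP hd; apply/eqP; rewrite linearB /= hc hd subrr.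
Qed.

HB.instance Definition _ k :=
  GRing.isZmodClosed.Build (chain G D k) (@is_cycle k) (@is_cycle_zmod_closed k).

Record sing_cycle k := Cycle {
  cycle_chain : chain G D k;
  cycleP : cycle_chain \in @is_cycle k }.

HB.instance Definition _ k := [isSub for @cycle_chain k].
HB.instance Definition _ k := [Choice of sing_cycle k by <:].
HB.instance Definition _ k := [SubChoice_isSubZmodule of sing_cycle k by <:].

Definition is_boundary k : pred (sing_cycle k) :=
  fun z => `[< exists c : chain G D k.+1, bd c = cycle_chain z >].

Lemma is_boundary_zmod_closed k : zmod_closed (@is_boundary k).
Proof.
split=> [|y z]; rewrite !unfold_in; first by apply/asboolP; exists 0; rewrite linear0.
move=> /asboolP[c cy] /asboolP[d dz]; apply/asboolP; exists (c - d).
by rewrite linearB /= cy dz.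
Qed.

HB.instance Definition _ k :=
  GRing.isZmodClosed.Build (sing_cycle k) (@is_boundary k) (@is_boundary_zmod_closed k).

Definition boundaries k : zmodClosed (sing_cycle k) :=
  GRing.ZmodClosed.clone _ (@is_boundary k) _.

Definition homology k : zmodType := Quotient.quot (boundaries k).

Definition homology_class k (z : sing_cycle k) : homology k :=
  (\pi_(Quotient.quot (boundaries k)) z)%qT.

End OneFamily.

Record chain_mor (T S : topologicalType) (D : simp_family R T)
    (E : simp_family R S) := ChainMor {
  mor :> forall k, {linear chain G D k -> chain G E k};
  mor_bd : forall k (c : chain G D k.+1), bd (mor k.+1 c) = mor k (bd c);
  mor_aug : forall c : chain G D 0, aug (mor 0%N c) = aug c }.

Section Inclusion.
Variables (T : topologicalType) (D E : simp_family R T) (DE : subfamily D E).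

Definition sub_simp k (s : D k) : E k :=
  SigSub (mem_set (@DE k _ (set_valP s))).

Definition sub_chain k : {linear chain G D k -> chain G E k} :=
  lin_ext (fun s : D k => gen (sub_simp s)).

Lemma sub_chain_bd k (c : chain G D k.+1) :
  bd (sub_chain k.+1 c) = sub_chain k (bd c).
Proof.
apply: (eq_on_basis (u := @bd _ E k \o sub_chain k.+1)
  (v := sub_chain k \o @bd _ D k)) => s /=.
rewrite [sub_chain k.+1 _]lin_extU [bd << s >>]lin_extU.
rewrite [bd _]lin_extU linear_sum; apply: eq_bigr => i _.
rewrite linearZ /= [lin_ext _ _]lin_extU; congr (_ *: gen _).
exact: val_inj.
Qed.

Lemma sub_chain_aug (c : chain G D 0) : aug (sub_chain 0 c) = aug c.
Proof.
apply: (eq_on_basis (u := @aug _ E \o sub_chain 0) (v := @aug _ D)) => s /=.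
by rewrite [sub_chain 0 _]lin_extU /aug [LHS]lin_extU [RHS]lin_extU.
Qed.

Definition inclusion : chain_mor D E := ChainMor sub_chain_bd sub_chain_aug.

End Inclusion.

Section Induced.
Variables (T S : topologicalType) (D : simp_family R T) (E : simp_family R S).
Variable phi : chain_mor D E.

Lemma mor_cycle k (z : sing_cycle D k) : phi k (cycle_chain z) \in @is_cycle _ E k.
Proof.
case: k z => [|k] z; have := cycleP z; rewrite !unfold_in /=.
  by rewrite mor_aug.
by rewrite mor_bd => /eqP->; rewrite linear0.
Qed.

Definition cycle_map k (z : sing_cycle D k) : sing_cycle E k := Cycle (mor_cycle z).

Definition homology_map k (h : homology D k) : homology E k :=
  homology_class (cycle_map (repr h)).

Lemma homology_mapE k (z : sing_cycle D k) :
  homology_map (homology_class z) = homology_class (cycle_map z).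
Proof.
apply/eqmodP; rewrite /= /Quotient.equiv unfold_in /=; apply/asboolP.
have : (repr (homology_class z) - z) \in boundaries D k.
  by rewrite Quotient.idealrBE reprK.
by rewrite unfold_in => /asboolP[c bc]; exists (phi k.+1 c); rewrite mor_bd bc linearB.
Qed.

Lemma homology_map_is_zmod_morphism k : zmod_morphism (@homology_map k).
Proof.
move=> x y.
have classB S' (F : simp_family R S') (u v : sing_cycle F k) :
  homology_class (u - v) = homology_class u - homology_class v by exact: raddfB.
have classK (h : homology D k) : h = homology_class (repr h).
  by rewrite /homology_class reprK.
rewrite (classK x) (classK y) -classB !homology_mapE -classB.
by congr homology_class; apply: val_inj; rewrite /= linearB.
Qed.

HB.instance Definition _ k := GRing.isZmodMorphism.Build
  (homology D k) (homology E k) (@homology_map k) (@homology_map_is_zmod_morphism k).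

End Induced.

Section Composition.
Variables (T S Q : topologicalType).
Variables (D : simp_family R T) (E : simp_family R S) (F : simp_family R Q).
Variables (psi : chain_mor E F) (phi : chain_mor D E).

Definition comp_chain k : {linear chain G D k -> chain G F k} := psi k \o phi k.

Lemma comp_chain_bd k (c : chain G D k.+1) :
  bd (comp_chain k.+1 c) = comp_chain k (bd c).
Proof. by rewrite /= !mor_bd. Qed.

Lemma comp_chain_aug (c : chain G D 0) : aug (comp_chain 0 c) = aug c.
Proof. by rewrite /= !mor_aug. Qed.

Definition comp_mor : chain_mor D F := ChainMor comp_chain_bd comp_chain_aug.

End Composition.

Definition restrict_mor (T S : topologicalType) (D D' : simp_family R T)
    (E : simp_family R S) (phi : chain_mor D E) (DD : subfamily D' D) :
  chain_mor D' E := comp_mor phi (inclusion DD).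

Section Properties.
Variables (T S : topologicalType) (D : simp_family R T) (E : simp_family R S).
Implicit Types (phi psi : chain_mor D E) (W : set (set S)).

Definition correct_mor phi : Prop :=
  forall s : D 0%N, exists t : E 0%N, phi 0%N (gen s) = gen t.

Definition close_mor W phi psi : Prop :=
  forall k (s : D k), exists2 B, W B &
    forall j (t : D j), is_face (set_val t) (set_val s) ->
      carrier (phi j (gen t)) `|` carrier (psi j (gen t)) `<=` B.

Definition small_mor W phi : Prop :=
  forall k (s : D k), exists2 B, W B &
    forall j (t : D j), is_face (set_val t) (set_val s) ->
      carrier (phi j (gen t)) `<=` B.

End Properties.

(* A point of the subspace A as a 0-simplex of S(A). *)
Lemma point_sing_in (T : topologicalType) (A : set T) (z : A) :
  point_sing R (set_val z) \in sing_in R A 0%N.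
Proof. by apply/mem_set => x /point_carrier ->; exact: set_valP. Qed.

Definition point_in (T : topologicalType) (A : set T) (z : A) : sing_in R A 0%N :=
  SigSub (point_sing_in z).

(* The quantifier over z' refers to the subspace topology of A. *)
Definition continuous_mor (T S : topologicalType) (A : set T)
    (E : simp_family R S) (phi : chain_mor (sing_in R A) E) : Prop :=
  forall (z : A) (U : set S), set_nbhs (carrier (phi 0%N (gen (point_in z)))) U ->
    \forall z' \near z, carrier (phi 0%N (gen (point_in z'))) `<=` U.

Definition homologically_UV_set (n : nat) (X : topologicalType) (A : set X) : Prop :=
  closed A /\
  forall U, set_nbhs A U -> exists V, exists VU : V `<=` U, set_nbhs A V /\
    forall k, (k <= n)%N ->
      forall h : homology (sing_in R V) k,
        homology_map (inclusion (sing_in_sub VU)) h = 0.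

Definition homologically_UV_map (n : nat) (X Y : topologicalType) (f : X -> Y) :
  Prop :=
  (forall y, exists x, f x = y) /\
  forall y, homologically_UV_set n (f @^-1` [set y]).

End Chains.

(* Main.v *)
(* As [f] is closed with UV^n fibres, [Y] carries a tower of open covers
   [W 0, ..., W n.+2 = U] in which every star of a member of [W k] lies in a member
   of [W k.+1], the inclusion of the preimages inducing zero in homology up to
   degree [n]; [V] is [W 0].  In degree 0 the morphism [phi] is a map from [A] to
   [X].  Since [dim M <= n+1], there are a family [alpha] of open sets covering [A]
   and an assignment [c] of points of [A] to the points of their union which takes
   at most [n+2] values on each member [B] of [alpha], all of them close to [B].
   A small singular simplex is sent to the list of the values of [c] at its
   vertices, then to the alternating sum which sorts this list (and vanishes above
   degree [n+1]); finally the sorted lists are realized by singular chains of [X],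
   degree by degree, climbing one step of the tower for each degree. *)
Require Import Defs.
From HB Require Import structures.
From mathcomp Require Import all_boot all_order all_algebra.
From mathcomp Require Import all_classical all_reals all_analysis.
From mathcomp Require Import freeg zify lra.
From mathcomp Require wochoice.

Set Implicit Arguments.
Unset Strict Implicit.
Unset Printing Implicit Defensive.

Import Order.TTheory GRing.Theory Num.Theory.
Import numFieldNormedType.Exports.

Local Open Scope classical_set_scope.
Local Open Scope ring_scope.

(** * Star refinements in paracompact spaces *)

Section StarRefinements.
Variable T : topologicalType.
Implicit Types (U V : set (set T)) (B C : set T).

Definition star V B : set T := \bigcup_(C in [set C | V C /\ C `&` B !=set0]) C.

Definition star_refines V U : Prop :=
  forall B, V B -> exists2 C, U C & star V B `<=` C.

Lemma nbhs_finite_bigcap (I : choiceType) (D : set I) (F : I -> set T) (x : T) :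
  finite_set D -> (forall i, D i -> nbhs x (F i)) ->
  nbhs x (\bigcap_(i in D) F i).
Proof.
move=> /finite_fsetP[D' ->] DF; apply: filter_bigI => i iD.
by apply: DF.
Qed.

(** By local finiteness only finitely many members meet some neighborhood [N] of [x]; the closures
    of all the others miss the interior of [N]. *)
Lemma locally_finite_nbhs V (x : T) : locally_finite V ->
  nbhs x (\bigcap_(B in [set B | V B /\ ~ closure B x]) ~` closure B).
Proof.
move=> /(_ x)[N Nx finN].
pose F := [set B | [set B | V B /\ B `&` N !=set0] B /\ ~ closure B x].
have finF : finite_set F by apply: sub_finite_set finN => B [].
have : nbhs x (N° `&` \bigcap_(B in F) ~` closure B).
  apply: filterI; first exact: nbhs_interior.
  apply: nbhs_finite_bigcap => // B [_ nBx].
  by apply: open_nbhs_nbhs; split=> //; apply/closed_openC/closed_closure.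
apply: filterS => z [Nz Fz] B [VB nBx] Bz; apply: (Fz B) => //; split=> //.
split=> //; have [w [Bw Nw]] := Bz _ Nz.
by exists w.
Qed.

Lemma locally_finite_closed V U : locally_finite V -> U `<=` V ->
  closed (\bigcup_(B in U) closure B).
Proof.
move=> lfV UV x clx; apply: contrapT => nx.
have [z [[B UB Bz] /(_ B)]] := clx _ (locally_finite_nbhs x lfV).
by apply=> //; split; [exact: UV | move=> Bx; apply: nx; exists B].
Qed.

Lemma locally_finite_closure_finite V (x : T) : locally_finite V ->
  finite_set [set B | V B /\ closure B x].
Proof.
move=> /(_ x)[N Nx]; apply: sub_finite_set => B [VB Bx]; split=> //.
by have [w ?] := Bx _ Nx; exists w.
Qed.

Hypothesis T_paracompact : paracompact T.

(** Regularity of paracompact spaces. Take a locally finite refinement of the cover by [C] and by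
    the open sets whose closure misses [x]: the closures missing [x] have a closed union, whose
    complement is the required set. *)
Lemma paracompact_shrink_nbhs C (x : T) : open C -> C x ->
  exists B, [/\ open B, B x & closure B `<=` C].
Proof.
move=> oC Cx; have [hT pT] := T_paracompact.
have [|V [[oV cV] rV lfV]] :=
  pT ([set C] `|` [set B | open B /\ ~ closure B x]).
  split; first by move=> B [-> //|[]].
  move=> y _; have [Cy|nCy] := pselect (C y); first by exists C => //; left.
  have yx : y != x by apply/eqP => yx; apply: nCy; rewrite yx.
  move: hT; rewrite open_hausdorff => /(_ y x yx)[[N M] /=].
  rewrite !inE => -[Ny Mx] [oN oM NM].
  exists N => //; right; split=> // /(_ M) []; first exact: open_nbhs_nbhs.
  by move=> z; rewrite NM.
pose O := \bigcup_(B in [set B | V B /\ ~ closure B x]) closure B.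
have clO : closed O by apply: locally_finite_closed lfV _ => B [].
exists (~` O); split; [exact: closed_openC | by move=> [B []] |].
pose Q := \bigcup_(B in [set B | V B /\ ~ closure B x]) B.
have cC : ~` C `<=` Q.
  move=> y nCy; have [B VB By] := cV y I.
  exists B => //; split=> // Bx; have [D [->|[oD nDx]] BD] := rV _ VB.
    by case: nCy; exact: BD.
  by apply: nDx; exact: closureS BD _ Bx.
have oQ : open Q by apply: bigcup_open => B [VB _]; have [] := oV _ VB.
have QO : ~` O `<=` ~` Q.
  by apply: subsetC => z [B VB Bz]; exists B => //; exact: subset_closure.
apply: subset_trans (closureS QO) _.
have <- := (closure_id _).1 (open_closedC oQ).
by move=> z nQz; apply: contrapT => /cC.
Qed.

(** Barycentric refinement. If [z] lies both in a member [B] of the locally finite cover and in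
    [N y], then [y] is in [closure B], whence [N y] lies in [g B]; thus one [g B] contains every
    [N y] around [z]. *)
Lemma paracompact_point_star U : open_cover setT U ->
  exists2 V, open_cover setT V &
    forall y, exists2 C, U C & forall B, V B -> B y -> B `<=` C.
Proof.
move=> [oU cU]; have [hT pT] := T_paracompact.
have [|V [[oV cV] rV lfV]] := 
    pT [set B | open B /\ exists2 C, U C & closure B `<=` C].
  split=> [B [] //|y _]; have [C UC Cy] := cU y I.
  have [oC _] := oU _ UC.
  have [B [oB By BC]] := paracompact_shrink_nbhs oC Cy.
  by exists B => //; split=> //; exists C.
have /choice[g gP] : forall B, exists C, V B -> U C /\ closure B `<=` C.
  move=> B; have [VB|] := pselect (V B); last by exists setT.
  have [D [_ [C UC DC]] BD] := rV _ VB; exists C => _; split=> //.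
  exact: subset_trans (closureS BD) DC.
pose N y := (\bigcap_(B in [set B | V B /\ closure B y]) g B) `&`
  (\bigcap_(B in [set B | V B /\ ~ closure B y]) ~` closure B).
have nN y : nbhs y (N y).
  apply: filterI; last exact: locally_finite_nbhs.
  apply: nbhs_finite_bigcap; first exact: locally_finite_closure_finite.
  move=> B [VB By]; have [Ug Bg] := gP _ VB.
  by apply: open_nbhs_nbhs; split; [have [] := oU _ Ug | exact: Bg].
exists (range (fun y => (N y)°)).
  split=> [_ [y _ <-]|y _]; first by split=> //; exact: open_interior.
  by exists (N y)° => //; exact: nN.
move=> z; have [B VB Bz] := cV z I; have [Ug Bg] := gP _ VB.
exists (g B) => // _ [y _ <-] /interior_subset Nz w /interior_subset [Nw _].
apply: (Nw B); split=> //; apply: contrapT => nBy.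
by apply: (Nz.2 B) => //; exact: subset_closure.
Qed.

(** A barycentric refinement of a barycentric refinement is a star refinement. Empty members are
    dropped so that each member has a point at which the first refinement can be applied. *)
Lemma paracompact_star_refinement U : open_cover setT U ->
  exists2 V, open_cover setT V & star_refines V U.
Proof.
move=> /paracompact_point_star[V /paracompact_point_star[W [oW cW] WV] VU].
exists [set B | W B /\ B !=set0].
  split=> [B [WB _]|y _]; first exact: oW.
  by have [B WB By] := cW y I; exists B => //; split=> //; exists y.
move=> B [WB [y By]]; have [C UC VC] := VU y.
exists C => // z [D [[WD _] [w [Dw Bw]]] Dz].
have [E VE WE] := WV w.
by apply: (VC E) => //; [exact: (WE B) | exact: (WE D)].
Qed.

End StarRefinements.

(** * Covering dimension of metric spaces *)

Section Shrinking.
Variables (T : topologicalType) (m : nat).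
Hypotheses (T_normal : normal_space T) (T_dim : dim_le T m).
Implicit Types O P : nat -> set T.

Definition nat_cover O : Prop :=
  (forall i, open (O i)) /\ forall x, exists i, O i x.

Lemma normal_shrink1 O i : nat_cover O ->
  exists P, [/\ nat_cover P, closure (P i) `<=` O i &
    forall j, j != i -> P j = O j].
Proof.
(* [F] is the closed set of points covered by [O i] alone. *)
move=> [oO cO]; pose F := ~` \bigcup_(j in [set j | j != i]) O j.
have clF : closed F by apply/open_closedC/bigcup_open.
have FO : set_nbhs F (O i).
  move=> x Fx; apply: open_nbhs_nbhs; split=> //.
  have [j Oj] := cO x; have [ji|ji] := eqVneq j i; first by rewrite -ji.
  by exfalso; apply: Fx; exists j.
have [C FC CO] := T_normal clF FO.
exists (fun j => if j == i then C° else O j); split=> [|| j /negPf-> //].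
  split=> [j|x]; first by case: ifP => // _; exact: open_interior.
  have [[j /= ji Oj]|Fx] := pselect ((\bigcup_(j in [set j | j != i]) O j) x).
    by exists j; rewrite (negPf ji).
  by exists i; rewrite eqxx; exact: FC.
by rewrite eqxx; apply: subset_trans CO; apply: closureS; exact: interior_subset.
Qed.

Lemma normal_shrink O k : nat_cover O ->
  exists P, [/\ nat_cover P, forall i, (i < k)%N -> closure (P i) `<=` O i &
    forall i, P i `<=` O i].
Proof.
move=> cO; elim: k => [|k [P [cP clP PO]]]; first by exists O; split=> // i ? //.
have [Q [cQ clQ QP]] := normal_shrink1 k cP.
have QPi i : Q i `<=` P i.
  have [->|/QP-> //] := eqVneq i k.
  exact: subset_trans (@subset_closure _ _) clQ.
exists Q; split=> // i; last exact: subset_trans (QPi i) (PO i).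
rewrite ltnS leq_eqVlt => /predU1P[->|ik].
  exact: subset_trans clQ (PO k).
by rewrite QP ?ltn_eqF //; exact: clP.
Qed.

Lemma card_le_uniq (J : choiceType) (A : set J) (s : seq J) n :
  uniq s -> (forall i, i \in s -> A i) -> (A #<= `I_n)%card ->
  (size s <= n)%N.
Proof.
move=> us sA An; apply: leq_trans (geq_card_fset_set An).
apply: uniq_leq_size => // x /sA Ax; rewrite in_fset_set ?inE //.
by apply/finite_set_leP; exists n.
Qed.


Lemma dim_shrink O k : nat_cover O ->
  exists P, [/\ nat_cover P, forall i, (i <= k)%N -> closure (P i) `<=` O i,
    forall i, P i `<=` O i &
    forall x s, uniq s -> (forall i, i \in s -> (i <= k)%N /\ P i x) ->
      (size s <= m.+1)%N].
Proof.
move=> /(normal_shrink k.+1)[Q [[oQ cQ] clQ QO]].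
(* [dim_le] speaks of finite covers, so the members beyond [k] are merged into the one of index
   [k.+1]. *)
pose R i := if (i <= k)%N then Q i else \bigcup_(j in [set j | (k < j)%N]) Q j.
have [||V [[oV cV] _ rV VO]] := T_dim (U := R @` `I_k.+2).
- split=> [_ [i _ <-]|x _].
    split=> //; rewrite /R; case: ifP => // _.
    by apply: bigcup_open.
  have [i Qi] := cQ x; have [ik|ki] := leqP i k.
    by exists (Q i) => //; exists i; rewrite /= /R ?ik //; lia.
  by exists (R k.+1); [exists k.+1 => /= | rewrite /R ltnn; exists i].
- exact/finite_image/finite_II.
have /choice[g gP] : forall B, exists i, V B -> (i < k.+2)%N /\ B `<=` R i.
  move=> B; have [VB|] := pselect (V B); last by exists 0%N.
  by have [_ [i ik <-] BR] := rV _ VB; exists i.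
(* Indices beyond [k] share the group [k.+1] and are told apart by [Q i]; distinct indices up to [k]
   use distinct members of [V], which gives the order bound. *)
pose h i := minn i k.+1.
exists (fun i => Q i `&` \bigcup_(B in [set B | V B /\ g B = h i]) B); split.
- split=> [i|x].
    apply: openI => //; apply: bigcup_open => B [VB _].
    by have [] := oV _ VB.
  have [B VB Bx] := cV x I; have [gk /(_ _ Bx)] := gP _ VB.
  rewrite /R; case: leqP => [gBk Qx|kg [j kj Qx]].
    by exists (g B); split=> //; exists B => //; split=> //; rewrite /h; lia.
  exists j; split=> //; exists B => //; split=> //; rewrite /h.
  by move: kj => /=; lia.
- move=> i ik; apply: subset_trans (clQ i _); last by lia.
  by apply: closureS => x [].
- by move=> i x [/QO].
move=> x s us sP.
have /choice[f fP] : forall i, exists B, i \in s -> [/\ V B, B x & g B = i].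
  move=> i; have [/sP[ik [_ [B [VB gB] Bx]]]|] := boolP (i \in s).
    by exists B => _; split=> //; rewrite gB /h; lia.
  by exists set0.
rewrite -(size_map f s); apply: card_le_uniq (VO x).
  rewrite map_inj_in_uniq // => i j si sj fij.
  have [_ _ gi] := fP _ si; have [_ _ gj] := fP _ sj.
  have [ik _] := sP _ si; have [jk _] := sP _ sj.
  by move: gi gj; rewrite fij => ->; rewrite /h; lia.
by move=> _ /mapP[i si ->]; have [] := fP _ si.
Qed.

(* At stage [k] the finite cover [O 0, ..., O k, \bigcup_(i > k) O i] is shrunk to
   order [m], the closures of the new sets lying in the old ones, so that the
   limit sets are closed; by local finiteness they still cover. *)
Lemma locally_finite_closed_shrink O : nat_cover O ->
  (forall x : T, exists k, \forall y \near x, forall i, (k < i)%N -> ~ O i y) ->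
  exists F : nat -> set T, [/\ forall i, closed (F i), forall i, F i `<=` O i,
    forall x, exists i, F i x &
    forall x s, uniq s -> (forall i, i \in s -> F i x) -> (size s <= m.+1)%N].
Proof.
move=> cO lfO.
have /choice[step stepP] : forall kP : nat * (nat -> set T), exists P,
    nat_cover kP.2 -> [/\ nat_cover P,
      forall i, (i <= kP.1)%N -> closure (P i) `<=` kP.2 i,
      forall i, P i `<=` kP.2 i &
      forall x s, uniq s -> (forall i, i \in s -> (i <= kP.1)%N /\ P i x) ->
      (size s <= m.+1)%N].
  move=> [k P]; have [/(dim_shrink k)[Q QP]|] := pselect (nat_cover P).
    by exists Q.
  by exists P.
pose P := fix P k := if k is k'.+1 then step (k', P k') else O.
have cP k : nat_cover (P k).
  by elim: k => // k IH; have [] := stepP (k, P k) IH.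
have PS k : [/\ forall i, (i <= k)%N -> closure (P k.+1 i) `<=` P k i,
      forall i, P k.+1 i `<=` P k i &
      forall x s, uniq s -> (forall i, i \in s -> (i <= k)%N /\ P k.+1 i x) ->
      (size s <= m.+1)%N].
  by have [] := stepP (k, P k) (cP k).
have Pmono k l i : (k <= l)%N -> P l i `<=` P k i.
  elim: l => [|l IH]; first by rewrite leqn0 => /eqP->.
  rewrite leq_eqVlt ltnS => /predU1P[-> //|/IH].
  by apply: subset_trans; have [] := PS l.
pose F i := \bigcap_k P k i.
have FE i : F i = \bigcap_(k in [set k | (i <= k)%N]) closure (P k.+1 i).
  apply/seteqP; split=> x Fx k _.
    by apply: subset_closure; apply: Fx.
  have [+ _ _] := PS (maxn i k) => /(_ i (leq_maxl _ _) x (Fx _ (leq_maxl _ _))).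
  by apply: Pmono; exact: leq_maxr.
exists F; split=> [i|i x /(_ 0%N I) //|x|x s us sF].
- by rewrite FE; apply: closed_bigI => k _; exact: closed_closure.
(* If every index eventually loses [x], then at some stage [x] is in no set of index at most [k],
   and in none of larger index by local finiteness, although each stage is a cover. *)
- apply: contrapT => nF; have [k /nbhs_singleton kO] := lfO x.
  have /choice[g gP] : forall i, exists l, ~ P l i x.
    move=> i; apply: contrapT => nP; apply: nF; exists i => l _.
    by apply: contrapT => nPl; apply: nP; exists l.
  have [i Pi] := (cP (\max_(i < k.+1) g i)).2 x.
  have [ik|/kO] := leqP i k; last by apply; exact: (Pmono 0%N _ _ _ _ Pi).
  apply: (gP i); apply: Pmono Pi.
  exact: (leq_bigmax (Ordinal (ik : (i < k.+1)%N))).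
have [_ _] := PS (\max_(i <- s) i); apply=> [//|i si]; split; last exact: sF.
exact: leq_bigmax_seq.
Qed.

End Shrinking.

(** * Well-orders and sigma-disjoint open refinements *)

Lemma well_ordering (T : eqType) : exists le : rel T,
  [/\ antisymmetric le, transitive le, total le &
    forall P : set T, P !=set0 -> exists2 x, P x & forall y, P y -> le x y].
Proof.
have [le wo] := @wochoice.well_ordering_principle T.
have wo' : @wochoice.wo_chain T le predT by move=> A _; exact: wo.
have min (P : set T) : P !=set0 -> exists2 x, P x & forall y, P y -> le x y.
  move=> [x Px]; have [|y [[/asboolP Py yP] _]] := wo (fun x => `[< P x >]).
    by exists x; apply/asboolP.
  by exists y => // z Pz; apply: yP; apply/asboolP.
have anti : antisymmetric le.
  by move=> x y; apply: (wochoice.wo_chain_antisymmetric wo').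
exists le; split=> // [y x z xy yz|x y]; last first.
  by apply: (wochoice.wo_chainW wo').
(* Transitivity is read off the least of the three elements; if it is [y] or [z], antisymmetry
   identifies two of them. *)
have [|w ww wmin] := min [set x; y; z]; first by exists x; left; left.
case: ww => [[|]|] /= we; subst w.
- by apply: wmin; right.
- have -> : x = y by apply: anti; rewrite xy wmin //; left; left.
  by [].
- have <- : y = z by apply: anti; rewrite yz wmin //; left; right.
  by [].
Qed.

Section Stone.
Variables (R : realType) (M : pseudoMetricType R) (I : choiceType).
Variable O : I -> set M.
Hypotheses (O_open : forall i, open (O i)) (O_cover : forall x, exists i, O i x).

(* M. E. Rudin's argument: a point whose 2/(n+1)-ball lies in the first [O i]
   (for a well-order of [I]) containing it is at distance at least 2/(n+1) from
   the points of the same kind attached to another index. *)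
Lemma sigma_disjoint_refinement : exists E : nat -> I -> set M,
  [/\ forall n i, open (E n i), forall n i, E n i `<=` O i,
    forall n i j x, E n i x -> E n j x -> i = j &
    forall x, exists n i, E n i x].
Proof.
have [W [Wanti _ _ Wmin]] := well_ordering I.
have /choice[f fP] : forall x, exists i, O i x /\ forall j, O j x -> W i j.
  by move=> x; have [i Oi iP] := Wmin (O^~ x) (O_cover x); exists i.
pose e n : R := n.+1%:R^-1.
have e0 n : 0 < e n by rewrite invr_gt0 ltr0n.
pose E n i := \bigcup_(x in [set x | f x = i /\ ball x (e n + e n) `<=` O i])
  (ball x (e n))°.
exists E; split=> [n i|n i z [x [_ xO] /interior_subset xz]|n i j z|x].
- by apply: bigcup_open => x _; exact: open_interior.
- by apply: xO; apply: le_ball xz; rewrite lerDl ltW.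
- move=> [x [<- xO] /interior_subset xz] [y [<- yO] /interior_subset yz].
  have xy : ball x (e n + e n) y by apply: ball_triangle xz (ball_sym yz).
  apply: Wanti; apply/andP; split.
    by apply: (fP x).2; exact/yO/ball_sym.
  by apply: (fP y).2; exact: xO.
have /nbhs_ballP[r /= r0 xr] : nbhs x (O (f x)).
  by apply: open_nbhs_nbhs; split=> //; have [] := fP x.
have r20 : 0 < r / 2 by rewrite divr_gt0.
have [k _ /(_ k (leqnn k)) /= kr] := near_infty_natSinv_lt (PosNum r20).
exists k, (f x), x; last exact: nbhsx_ballx.
split=> //; apply: subset_trans xr; apply: le_ball.
by rewrite [leRHS]splitr lerD // ltW.
Qed.
End Stone.


(** * Covers of bounded order indexed by arbitrary sets *)

Section DimensionOfPseudoMetric.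
Variables (R : realType) (M : pseudoMetricType R).

(** From [O j.+1] one removes the closure of the set of points whose [e j]-ball lies in the union
    [V j] of the earlier sets. The first [O i] containing a point keeps it, as [closure (D j)] lies
    in [V j]; near a point of [O i] all late sets are removed. *)
Lemma locally_finite_shrink (O : nat -> set M) : nat_cover O ->
  exists P, [/\ nat_cover P, forall i, P i `<=` O i &
    forall x : M, exists k, \forall y \near x, forall i, (k < i)%N -> ~ P i y].
Proof.
move=> [oO cO]; pose e n : R := n.+1%:R^-1.
have e0 n : 0 < e n by rewrite invr_gt0 ltr0n.
have emono k n : (k <= n)%N -> e n <= e k.
  by move=> kn; rewrite lef_pV2 ?posrE ?ltr0n // ler_nat ltnS.
pose V j := \bigcup_(i in [set i | (i <= j)%N]) O i.
have Vmono j k : (j <= k)%N -> V j `<=` V k.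
  by move=> jk x [i ij Oi]; exists i => //; exact: leq_trans ij jk.
pose D j := [set x | ball x (e j) `<=` V j].
have DV j : closure (D j) `<=` V j.
  move=> x /(_ _ (nbhsx_ballx x _ (e0 j)))[z [Dz xz]].
  exact/Dz/ball_sym.
exists (fun i => if i is j.+1 then O i `\` closure (D j) else O i).
split=> [|[//|i] x []//|x].
  split=> [[//|i]|x].
    by apply: openI => //; exact/closed_openC/closed_closure.
  have /ex_minnP[i /asboolP Oi imin] : exists i, `[< O i x >].
    by have [i Oi] := cO x; exists i; apply/asboolP.
  exists i; case: i Oi imin => // i Oi imin; split=> // /DV[j /= ji Oj].
  by have := imin j; rewrite ltnNge ji => /(_ (asboolT Oj)).
have [i Oi] := cO x.
have /nbhs_ballP[r /= r0 xr] : nbhs x (O i) by apply: open_nbhs_nbhs.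
have r20 : 0 < r / 2 by rewrite divr_gt0.
(* [k] is at least [i], so that [V j] contains [O i] for [j >= k], and large enough for the radii
   [e k] and [e j] to add up to at most [r]. *)
have [k0 _ /(_ (maxn k0 i) (leq_maxl _ _)) /= kr] :=
  near_infty_natSinv_lt (PosNum r20).
set k := maxn k0 i in kr.
exists k; apply/nbhs_ballP; exists (e k) => //= y xy [//|j] kj [_]; apply.
apply: subset_closure => z yz; exists i; first by rewrite /k /= in kj *; lia.
apply: xr; apply: le_ball (ball_triangle xy yz).
rewrite [leRHS]splitr lerD //; first exact: ltW.
by apply: le_trans (ltW kr); apply: emono.
Qed.

(** At a fixed level [n] the sets [E n i] are disjoint, so choosing a level for a point chooses an
    index. The countably many levels shrink to closed sets [F n] of order [m], and near [w] only the
    levels with [F n w] can be chosen. *)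
Lemma dim_assignment (I : choiceType) (O : I -> set M) m : dim_le M m ->
  (forall i, open (O i)) -> (forall x, exists i, O i x) ->
  exists (alpha : set (set M)) (c : M -> I), open_cover setT alpha /\
    forall B, alpha B -> exists L : seq I, [/\ (size L <= m.+1)%N,
      forall v, B v -> c v \in L & forall i, i \in L -> B `<=` O i].
Proof.
move=> dimM oO cO.
have [E [oE EO disjE cE]] := sigma_disjoint_refinement oO cO.
have [|P [cP PE lfP]] := @locally_finite_shrink (fun n => \bigcup_i E n i).
  split=> [n|x]; first by apply: bigcup_open.
  by have [n [i Ei]] := cE x; exists n, i.
have [F [clF FP cF ordF]] :=
  locally_finite_closed_shrink pseudometric_normal dimM cP lfP.
have /choice[a aF] := cF.
have /choice[i0 i0O] := cO.
have /choice[g gE] : forall nx : nat * M, exists i, F nx.1 nx.2 -> E nx.1 i nx.2.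
  move=> [n x] /=; have [/FP/PE[i _ Ei]|] := pselect (F n x); first by exists i.
  by exists (i0 x).
pose c x := g (a x, x).
have loc (w : M) : exists B, nbhs w B /\ exists L : seq I, [/\ (size L <= m.+1)%N,
      forall v, B v -> c v \in L & forall i, i \in L -> B `<=` O i].
  have [k kP] := lfP w.
  pose s := [seq n <- iota 0 k.+1 | `[< F n w >]].
  have sF n : n \in s -> F n w by rewrite mem_filter => /andP[/asboolP].
  (* A level whose [F n] contains [w] keeps the index of [w]; the closed sets [F n] missing [w] are
     cut away. *)
  pose Q n := if n \in s then E n (g (n, w)) else ~` F n.
  exists ([set y | forall i, (k < i)%N -> ~ P i y] `&` \bigcap_(n in `I_k.+1) Q n).
  split.
    apply: filterI => //; apply: nbhs_finite_bigcap; first exact: finite_II.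
    move=> n nk; apply: open_nbhs_nbhs; rewrite /Q; case: ifPn => ns.
      by split=> //; apply: (gE (n, w)); exact: sF.
    split; first exact: closed_openC.
    move: ns; rewrite mem_filter mem_iota /= add0n nk andbT => /negP nF Fn.
    by apply: nF; exact/asboolP.
  exists [seq g (n, w) | n <- s]; split.
  - by rewrite size_map; apply: (ordF w) => //; exact/filter_uniq/iota_uniq.
  - move=> v [/= vP vQ]; have ak : (a v < k.+1)%N.
      by rewrite ltnS leqNgt; apply/negP => /vP; apply; apply/FP/aF.
    have := vQ _ ak; rewrite /Q; case: ifPn => [as_ Eav|_ /(_ (aF v))//].
    have -> : c v = g (a v, w) by exact: disjE (gE (a v, v) (aF v)) Eav.
    exact: map_f.
  move=> _ /mapP[n ns ->] v [_ /(_ n)]; rewrite /Q ns => /= h.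
  apply: EO; apply: h; move: ns; rewrite mem_filter mem_iota.
  by case/andP.
have /choice[B BP] := loc.
exists (range (fun w => (B w)°)), c; split.
  split=> [_ [w _ <-]|w _]; first by split=> //; exact: open_interior.
  by exists (B w)° => //; exact: (BP w).1.
move=> _ [w _ <-]; have [_ [L [sL cL LO]]] := BP w.
exists L; split=> // [v /interior_subset/cL //|i iL].
exact: subset_trans (@interior_subset _ _) (LO i iL).
Qed.

End DimensionOfPseudoMetric.

(** * Ordered chains *)

Section Support.
Variables (G : comNzRingType) (K : choiceType).
Implicit Types (P Q : K -> Prop) (c d : {freeg K / G}).

(** Membership in the span of part of the basis, kept as a predicate so that no submodule has to be
    built. *)
Definition supported P c : Prop := forall x, x \in dom c -> P x.

Lemma supportedS P Q c : (forall x, P x -> Q x) -> supported P c -> supported Q c.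
Proof. by move=> PQ Pc x /Pc/PQ. Qed.

Lemma supported0 P : supported P 0.
Proof. by move=> x; rewrite dom0. Qed.

Lemma supportedD P c d : supported P c -> supported P d -> supported P (c + d).
Proof. by move=> Pc Pd x /domD_subset; rewrite mem_cat => /orP[/Pc|/Pd]. Qed.

Lemma supportedZ P a c : supported P c -> supported P (a *: c).
Proof. by move=> Pc x /domZ_subset/Pc. Qed.

Lemma supportedN P c : supported P c -> supported P (- c).
Proof. by rewrite -scaleN1r; exact: supportedZ. Qed.

Lemma supportedU P x : P x -> supported P << x >>.
Proof. by move=> Px y; rewrite domU1 inE => /eqP->. Qed.

Lemma supported_sum P (I : Type) (r : seq I) (F : I -> {freeg K / G}) :
  (forall i, supported P (F i)) -> supported P (\sum_(i <- r) F i).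
Proof.
move=> PF; elim: r => [|i r IH]; first by rewrite big_nil; exact: supported0.
by rewrite big_cons; exact: supportedD.
Qed.

Lemma freegZU a (x : K) : << a *g x >> = a *: << x >> :> {freeg K / G}.
Proof. by apply/eqP/freeg_eqP => y; rewrite coeffZ !coeffU mul1r. Qed.

Lemma linear_supported (W : lmodType G) (u : {linear {freeg K / G} -> W}) c :
  u c = \sum_(x <- dom c) coeff x c *: u << x >>.
Proof.
rewrite -{1}(freeg_sumE c) linear_sum; apply: eq_bigr => x _.
by rewrite freegZU linearZ.
Qed.

Lemma eq_supported (W : lmodType G) (u v : {linear {freeg K / G} -> W}) P c :
  (forall x, P x -> u << x >> = v << x >>) -> supported P c -> u c = v c.
Proof.
move=> uv Pc; rewrite !linear_supported; apply: eq_big_seq => x /Pc/uv.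
by move=> ->.
Qed.

End Support.

Lemma linear_image_supported (G : comNzRingType) (K J : choiceType)
    (u : {linear {freeg K / G} -> {freeg J / G}}) (P : K -> Prop)
    (Q : J -> Prop) c :
  (forall x, P x -> supported Q (u << x >>)) -> supported P c ->
  supported Q (u c).
Proof.
move=> uQ Pc; rewrite linear_supported big_seq_cond.
rewrite (eq_bigr (fun x => if x \in dom c then coeff x c *: u << x >> else 0)).
  rewrite -big_seq_cond; apply: supported_sum => x; case: ifP => [/Pc/uQ|_].
    exact: supportedZ.
  exact: supported0.
by move=> x /andP[-> _].
Qed.

Section OrderedChains.
Variables (G : comNzRingType) (V : choiceType) (le : rel V).
Hypotheses (le_anti : antisymmetric le) (le_trans : transitive le)
  (le_total : total le).
Local Notation L := {freeg (seq V) / G}.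

Let lt : rel V := fun u v => (u != v) && le u v.

Let lt_trans : transitive lt.
Proof.
move=> v u w /andP[uv luv] /andP[vw lvw]; rewrite /lt (le_trans luv lvw) andbT.
apply/eqP => uw; move: vw; rewrite -uw in lvw *.
by rewrite (le_anti (introT andP (conj lvw luv))) eqxx.
Qed.

(** The cone with apex [v] in the ordered complex. *)
Definition lcons (v : V) : L -> L := lin_ext (fun l => << v :: l >>).

HB.instance Definition _ v := GRing.Linear.on (lcons v).

Lemma lconsU v l : lcons v << l >> = << v :: l >>.
Proof. exact: lin_extU. Qed.

(* The boundary in the augmented ordered complex: the empty list spans
   degree -1. *)
Fixpoint list_bd (l : seq V) : L :=
  if l is v :: l' then << l' >> - lcons v (list_bd l') else 0.

Definition lbd : L -> L := lin_ext list_bd.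

HB.instance Definition _ := GRing.Linear.on lbd.

Lemma lbdU l : lbd << l >> = list_bd l.
Proof. exact: lin_extU. Qed.

Lemma lbd_lcons v c : lbd (lcons v c) = c - lcons v (lbd c).
Proof.
apply: (eq_on_basis (u := lbd \o lcons v) (v := idfun \- (lcons v \o lbd))) => l /=.
by rewrite lconsU !lbdU.
Qed.

Lemma list_bdK l : lbd (list_bd l) = 0.
Proof.
elim: l => [|v l IH] /=; first by rewrite linear0.
by rewrite linearB /= lbd_lcons IH linear0 subr0 lbdU subrr.
Qed.

Lemma list_bdE l : list_bd l =
  \sum_(i < size l) (-1) ^+ i *: << take i l ++ drop i.+1 l >>.
Proof.
elim: l => [|v l IH] /=; first by rewrite big_ord0.
rewrite big_ord_recl expr0 scale1r take0 drop0 /= IH linear_sum -sumrN.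
congr (_ + _); apply: eq_bigr => i _.
by rewrite linearZ /= lconsU exprS mulN1r scaleNr.
Qed.

(* [v] inserted at its place in [l], with the sign of the exterior product. *)
Fixpoint list_wedge (v : V) (l : seq V) : L :=
  if l is u :: l' then
    if u == v then 0 else
    if le v u then << v :: l >> else - lcons u (list_wedge v l')
  else << [:: v] >>.

Definition wedge v : L -> L := lin_ext (list_wedge v).

HB.instance Definition _ v := GRing.Linear.on (wedge v).

Lemma wedgeU v l : wedge v << l >> = list_wedge v l.
Proof. exact: lin_extU. Qed.

Lemma wedge_lcons v u c : wedge v (lcons u c) =
  if u == v then 0 else
  if le v u then lcons v (lcons u c) else - lcons u (wedge v c).
Proof.
case: ifP => [uv|uv].
  apply: (eq_on_basis (u := wedge v \o lcons u) (v := \0)) => l /=.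
  by rewrite lconsU wedgeU /= uv.
case: ifP => vu.
  apply: (eq_on_basis (u := wedge v \o lcons u) (v := lcons v \o lcons u)) => l /=.
  by rewrite !lconsU wedgeU /= uv vu.
apply: (eq_on_basis (u := wedge v \o lcons u) (v := \- (lcons u \o wedge v)))
  => l /=.
by rewrite !lconsU !wedgeU /= uv vu.
Qed.

Lemma list_wedge_supported v l : sorted lt l ->
  supported (fun t => [/\ sorted lt t, {subset t <= v :: l} &
    size t = (size l).+1]) (list_wedge v l).
Proof.
elim: l => [_|u l IH ul] /=; first by apply: supportedU; split.
have [_|uv] := eqVneq u v; first exact: supported0.
case: ifPn => vu.
  by apply: supportedU; split=> //=; rewrite {1}/lt eq_sym uv vu.
have {vu} luv : lt u v.
  by rewrite /lt uv; have := le_total u v; rewrite (negPf vu) orbF.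
move: ul; rewrite /= path_sortedE // => /andP[/allP ul sl].
apply: supportedN; apply: linear_image_supported (IH sl) => t [st tl zt].
rewrite /= lconsU; apply: supportedU; split=> [||/=]; last by rewrite zt.
  rewrite /= path_sortedE // st andbT; apply/allP => w /tl; rewrite inE.
  by case/predU1P=> [->|/ul].
move=> w; rewrite !inE => /predU1P[->|/tl]; first by rewrite eqxx orbT.
by rewrite inE => /orP[->|->]; rewrite ?orbT.
Qed.

(** The cone formula passes from [lcons] to [wedge] on sorted lists only: in an unsorted list a copy
    of [v] behind a larger entry would go unnoticed. *)
Lemma lbd_list_wedge v l : sorted lt l ->
  lbd (list_wedge v l) = << l >> - wedge v (list_bd l).
Proof.
elim: l => [_|u l IH ul] /=; first by rewrite lbdU /= !linear0.
(* When [v] is at most [u] it precedes all of [l]; this serves both the case of a repetition and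
   that of insertion in front. *)
have wl : lt v u || (v == u) -> wedge v << l >> = << v :: l >>.
  move=> vu; rewrite wedgeU; case: l ul {IH} => //= w l /andP[uw _].
  have /andP[vw lvw] : lt v w.
    by case/orP: vu => [vu|/eqP->//]; exact: lt_trans uw.
  by rewrite eq_sym (negPf vw) lvw.
rewrite linearB /= wedge_lcons.
have [uv|uv] := eqVneq u v.
  by rewrite -uv in wl *; rewrite wl ?eqxx ?orbT // linear0 subr0 subrr.
case: ifPn => vu.
  rewrite wl; last by rewrite /lt eq_sym uv vu.
  by rewrite lbdU /= linearB /= lconsU.
rewrite linearN /= lbd_lcons IH ?(path_sorted ul) // linearB /= linearB /=
  lconsU wedgeU.
by rewrite !opprK opprD addrCA.
Qed.

(** The exterior product of the entries: zero if one is repeated, otherwise the sorted list with the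
    sign of the sorting permutation. *)
Fixpoint sort_chain (l : seq V) : L :=
  if l is v :: l' then wedge v (sort_chain l') else << [::] >>.

Lemma sort_chain_supported (l : seq V) :
  supported (fun t => [/\ sorted lt t, {subset t <= l} & size t = size l])
    (sort_chain l).
Proof.
elim: l => [|v l IH] /=; first by apply: supportedU; split.
apply: linear_image_supported IH => t [st tl zt].
rewrite /= wedgeU; apply: supportedS (list_wedge_supported st) => s [ss sv zs].
split=> //; last by rewrite zs zt.
by move=> w /sv; rewrite !inE => /orP[->//|/tl ->]; rewrite orbT.
Qed.

Definition lsort : L -> L := lin_ext sort_chain.

HB.instance Definition _ := GRing.Linear.on lsort.

Lemma lsortU l : lsort << l >> = sort_chain l.
Proof. exact: lin_extU. Qed.

(** Sorting is a chain map because [lcons] and [wedge] obey the same cone formula; the formula for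
    [wedge] is applied only on the support of [sort_chain l], which consists of sorted lists. *)
Lemma lbd_sort_chain l : lbd (sort_chain l) = lsort (list_bd l).
Proof.
elim: l => [|v l IH] /=; first by rewrite lbdU linear0.
have wl c : wedge v (lsort c) = lsort (lcons v c).
  apply: (eq_on_basis (u := wedge v \o lsort) (v := lsort \o lcons v)) => s /=.
  by rewrite lconsU !lsortU.
rewrite linearB /= lsortU -wl -IH.
apply: (@eq_supported _ _ _ (lbd \o wedge v) (idfun \- (wedge v \o lbd)) _ _
  _ (@sort_chain_supported l)) => s [ss _ _] /=.
by rewrite wedgeU lbdU; exact: lbd_list_wedge.
Qed.

(* A strictly sorted list has no repetition, so there are no sorted lists of
   more than [size s] elements of [s]. *)
Lemma sort_chain_eq0 (l s : seq V) : {subset l <= s} -> (size s < size l)%N ->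
  sort_chain l = 0.
Proof.
move=> ls sl; apply/eqP; rewrite -dom_eq0; case E : (dom _) => [//|t r].
have [] := @sort_chain_supported l t; first by rewrite E mem_head.
move=> st tl zt; have ut : uniq t.
  by apply: sorted_uniq st => // v; rewrite /lt eqxx.
have := uniq_leq_size ut (fun v vt => ls _ (tl _ vt)).
by rewrite zt leqNgt sl.
Qed.

End OrderedChains.

(** * Singular chains *)

Section SimplexVertices.
Variable R : realType.

Lemma vertex_std k (j : 'I_k.+1) :
  (delta_mx 0 j : 'rV[R]_k.+1) \in @std_simplex R k.
Proof.
apply/mem_set; split=> [i|]; first by rewrite mxE eqxx; case: eqP.
rewrite (bigD1 j) //= big1 ?addr0 ?mxE ?eqxx // => i ij.
by rewrite mxE (negPf ij).
Qed.

Definition vertex k (j : 'I_k.+1) : @std_simplex R k := SigSub (vertex_std j).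

Lemma affine_vertex j k (theta : 'I_j.+1 -> 'I_k.+1) i :
  affine theta (vertex i) = vertex (theta i).
Proof.
apply: val_inj => /=; apply/rowP => l; rewrite !mxE eqxx /=.
rewrite (eq_bigr (fun a => (a == i)%:R)); last by move=> a _; rewrite mxE eqxx.
have [->|il] := eqVneq l (theta i).
  by rewrite (bigD1 i) ?eqxx //= big1 ?addr0 // => a /andP[_ /negPf->].
rewrite big1 // => a /eqP al; case: eqP => // ai.
by rewrite -al ai eqxx in il.
Qed.

Lemma std_simplex0 (x : @std_simplex R 0) : x = vertex ord0.
Proof.
apply: val_inj; apply/rowP => i; have [_] := set_valP x.
by rewrite big_ord1 => x1; rewrite !ord1 mxE eqxx -x1.
Qed.

Lemma eq_sing (T : topologicalType) k (s t : sing R T k) : s =1 t -> s = t.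
Proof.
case: s t => [s cs] [t ct] /= st; have {}st : s = t by apply/funext.
by subst t; congr Sing; exact: Prop_irrelevance.
Qed.

Lemma sing0_point (T : topologicalType) (s : sing R T 0) :
  s = point_sing R (s (vertex ord0)).
Proof. by apply: eq_sing => x; rewrite (std_simplex0 x). Qed.

Lemma scarrier_point (T : topologicalType) (s : sing R T 0) :
  scarrier s = [set s (vertex ord0)].
Proof.
apply/seteqP; split=> [_ [x _ <-]|_ ->]; first by rewrite (std_simplex0 x).
by exists (vertex ord0).
Qed.

Definition vertices (T : topologicalType) k (s : sing R T k) : seq T :=
  [seq s (vertex i) | i <- enum 'I_k.+1].

End SimplexVertices.

(** * Chains carried by a subset, and vanishing of homology as filling of cycles *)

Section Restriction.
Variables (R : realType) (G : comNzRingType) (X : topologicalType).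
Implicit Types P Q : set X.
Local Notation S P := (sing_in R P).
Local Notation C k := (chain G (S [set: X]) k).

Definition in_carrier P k (s : S [set: X] k) : Prop := scarrier (set_val s) `<=` P.

Definition corestrict P k (s : S [set: X] k) (h : in_carrier P s) : S P k :=
  SigSub (mem_set (h : S P k (set_val s))).

Lemma carrierP P k (c : C k) :
  carrier c `<=` P <-> supported (@in_carrier P k) c.
Proof.
split=> [cP s sc x sx|cP x [s sc]]; first by apply: cP; exists s.
exact: cP.
Qed.

(** The value 0 off [P] is a default: the laws below concern chains carried by [P], on which the
    linear extension is a section of the inclusion. *)
Definition restrict_simplex P k (s : S [set: X] k) : chain G (S P) k :=
  match pselect (in_carrier P s) with
  | left h => gen G (corestrict h)
  | right _ => 0
  end.

Definition restrict_chain P k : C k -> chain G (S P) k :=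
  lin_ext (@restrict_simplex P k).

HB.instance Definition _ P k := GRing.Linear.on (@restrict_chain P k).

Lemma restrict_chainU P k (s : S [set: X] k) (h : in_carrier P s) :
  restrict_chain P << s >> = gen G (corestrict h).
Proof.
rewrite /restrict_chain lin_extU /restrict_simplex.
by case: pselect => // h'; congr (gen G _); exact: val_inj.
Qed.

Lemma sub_chainU (T : topologicalType) (D E : simp_family R T)
    (DE : subfamily D E) k (s : D k) :
  sub_chain G DE k << s >> = gen G (sub_simp DE s).
Proof. exact: lin_extU. Qed.

Lemma restrict_chainK P k (c : C k) : carrier c `<=` P ->
  sub_chain G (sing_in_sub (R := R) (@subsetT _ P)) k (restrict_chain P c) = c.
Proof.
move=> /carrierP; apply: (@eq_supported _ _ _
  (sub_chain G (sing_in_sub (R := R) (@subsetT _ P)) k \o @restrict_chain P k)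
  idfun) => s h /=.
rewrite restrict_chainU [LHS]lin_extU.
by congr << _ >>; exact: val_inj.
Qed.

Lemma bdU (T : topologicalType) (D : simp_family R T) k (s : D k.+1) :
  bd (gen G s) = \sum_(i < k.+2) (-1) ^+ i *: gen G (dface i s).
Proof. exact: lin_extU. Qed.

Lemma augU (T : topologicalType) (D : simp_family R T) (s : D 0%N) :
  aug (gen G s) = 1.
Proof. exact: lin_extU. Qed.

Lemma restrict_chain_bd P k (c : C k.+1) : carrier c `<=` P ->
  bd (restrict_chain P c) = restrict_chain P (bd c).
Proof.
move=> /carrierP; apply: (@eq_supported _ _ _ 
  (@bd _ _ _ (S P) k \o @restrict_chain P k.+1)
  (@restrict_chain P k \o @bd _ _ _ (S [set: X]) k)) => s h /=.
rewrite restrict_chainU bdU [bd << s >>]bdU linear_sum; apply: eq_bigr => i _.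
have hi : in_carrier P (dface i s).
  apply: subset_trans h; apply: face_carrier.
  by exists (fintype.lift i) => //; exact: lift_increasing.
rewrite linearZ /= restrict_chainU. congr (_ *: _); apply: congr1.
exact: val_inj.
Qed.

Lemma restrict_chain_aug P (c : C 0%N) : carrier c `<=` P ->
  aug (restrict_chain P c) = aug c.
Proof.
move=> /carrierP; apply: (@eq_supported _ _ _ 
  (@aug _ _ _ (S P) \o @restrict_chain P 0)
  (@aug _ _ _ (S [set: X]))) => s h /=.
by rewrite restrict_chainU augU [aug << s >>]augU.
Qed.

(* Triviality of the homomorphisms H_k(P) -> H_k(Q), k <= n, phrased inside the
   singular complex of the whole space. *)
Definition fills n P Q : Prop := forall k (c : C k), (k <= n)%N ->
  carrier c `<=` P -> is_cycle c -> exists2 d : C k.+1, bd d = c & carrier d `<=` Q.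

Lemma fillsS n P P' Q Q' : P `<=` P' -> Q' `<=` Q -> fills n P' Q' -> fills n P Q.
Proof.
move=> PP QQ f k c kn cP zc; have [d bd_d dQ] := f k c kn (subset_trans cP PP) zc.
by exists d => //; exact: subset_trans QQ.
Qed.

Lemma carrier_sub_chain Q k (d : chain G (S Q) k) :
  carrier (sub_chain G (sing_in_sub (R := R) (@subsetT _ Q)) k d) `<=` Q.
Proof.
apply/carrierP; apply: (@linear_image_supported _ _ _ _ xpredT) => // s _.
by rewrite sub_chainU; apply: supportedU; exact: (set_valP s).
Qed.

(** The cycle, restricted to [P], has a class that dies in [Q]; a chain of [Q] witnessing this is
    then viewed in the whole space. *)
Lemma homology_fills n P Q (PQ : P `<=` Q) :
  (forall k, (k <= n)%N -> forall h : homology G (S P) k,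
    homology_map (inclusion G (sing_in_sub PQ)) h = 0) ->
  fills n P Q.
Proof.
move=> H0 k c kn cP zc.
have zr : restrict_chain P c \in @is_cycle _ _ _ (S P) k.
  rewrite unfold_in; case: k c cP zc {kn} => [|k] c cP /eqP zc /=.
    by rewrite restrict_chain_aug ?zc.
  by rewrite restrict_chain_bd // zc linear0.
have := H0 k kn (homology_class (Cycle zr)); rewrite homology_mapE.
move=> h0.
have : homology_class (Defs.cycle_map (inclusion G (sing_in_sub PQ)) (Cycle zr))
    = homology_class (0 : sing_cycle G (S Q) k).
  by rewrite h0 /homology_class; exact/esym/raddf0.
move=> /eqmodP; rewrite /= /Quotient.equiv subr0 unfold_in => /asboolP[d bd_d].
exists (sub_chain G (sing_in_sub (R := R) (@subsetT _ Q)) k.+1 d).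
  rewrite sub_chain_bd bd_d /= -[RHS](restrict_chainK cP).
  apply: (eq_on_basis (u := sub_chain G (sing_in_sub (R := R) (@subsetT _ Q)) k
    \o sub_chain G (sing_in_sub PQ) k)) => s /=.
  rewrite [in RHS]lin_extU lin_extU [in LHS]lin_extU.
  by congr << _ >>; exact: val_inj.
exact: carrier_sub_chain.
Qed.

End Restriction.

Section OrderedFaces.
Variables (G : comNzRingType) (V : choiceType).

Lemma list_bd_supported (l : seq V) :
  supported (fun t : seq V => {subset t <= l} /\ (size t).+1 = size l) (list_bd G l).
Proof.
elim: l => [|v l IH] /=; first exact: supported0.
apply: supportedD.
  by apply: supportedU; split=> // w wl; rewrite inE wl orbT.
apply: supportedN; apply: linear_image_supported IH => t [tl zt] /=.
rewrite lconsU; apply: supportedU; split=> [w|/=]; last by rewrite zt.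
by rewrite !inE => /orP[->//|/tl->]; rewrite orbT.
Qed.

(** Omitted positions are written with [fintype.lift], as in [dface], so that the ordered boundary
    of a vertex list matches the singular one. *)
Lemma list_bd_enum k (g : 'I_k.+1 -> V) :
  list_bd G [seq g i | i <- enum 'I_k.+1] = \sum_(i < k.+1)
    (-1) ^+ i *: << [seq g (fintype.lift i j) | j <- enum 'I_k] >>.
Proof.
rewrite list_bdE size_map size_enum_ord; apply: eq_bigr => i _.
congr (_ *: << _ >>); set l := map g _.
have zl : size l = k.+1 by rewrite size_map size_enum_ord.
have nl (j : 'I_k.+1) : nth (g ord0) l j = g j.
  by rewrite (nth_map ord0) ?size_enum_ord // nth_ord_enum.
apply: (@eq_from_nth _ (g ord0)).
  rewrite size_cat size_take size_drop zl ltn_ord size_map size_enum_ord.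
  by case: i => /=; lia.
move=> j; rewrite size_cat size_take size_drop zl ltn_ord => jk.
have {}jk : (j < k)%N by move: jk; case: (i) => /=; lia.
rewrite (nth_map (Ordinal jk)) ?size_enum_ord // (nth_ord_enum _ (Ordinal jk)).
rewrite -[RHS]nl /= nth_cat size_take zl ltn_ord /bump; case: ltnP => ij.
  by rewrite nth_take.
by rewrite nth_drop; congr nth; lia.
Qed.

End OrderedFaces.

Section Vertices.
Variables (R : realType) (G : comNzRingType) (T : topologicalType).
Variable (V : choiceType) (c : T -> V).

Lemma size_vertices k (s : sing R T k) : size (vertices s) = k.+1.
Proof. by rewrite size_map size_enum_ord. Qed.

Lemma vertices_carrier k (s : sing R T k) x :
  x \in vertices s -> scarrier s x.
Proof. by move=> /mapP[i _ ->]; exists (vertex R i). Qed.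

Lemma list_bd_vertices (D : simp_family R T) k (s : D k.+1) :
  list_bd G [seq c x | x <- vertices (set_val s)] =
  \sum_(i < k.+2) (-1) ^+ i *:
    << [seq c x | x <- vertices (set_val (dface i s))] >>.
Proof.
rewrite /vertices -map_comp list_bd_enum; apply: eq_bigr => i _.
congr (_ *: << _ >>); rewrite -map_comp; apply: eq_map => j /=.
by rewrite affine_vertex.
Qed.

End Vertices.

Section ChainMorphisms.
Variables (R : realType) (G : comNzRingType) (T S : topologicalType).
Variables (D : simp_family R T) (E : simp_family R S).

Lemma chain_mor_basis (F : forall k, D k -> chain G E k) :
  (forall k (s : D k.+1), bd (F k.+1 s) =
    \sum_(i < k.+2) (-1) ^+ i *: F k (dface i s)) ->
  (forall s : D 0%N, aug (F 0%N s) = 1) ->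
  exists Phi : chain_mor G D E, forall k (s : D k), Phi k (gen G s) = F k s.
Proof.
move=> Fbd Faug; pose m k : {linear chain G D k -> chain G E k} := lin_ext (@F k).
have mU k (s : D k) : m k << s >> = F k s by exact: lin_extU.
have m_bd k (c : chain G D k.+1) : bd (m k.+1 c) = m k (bd c).
  apply: (eq_on_basis (u := @bd _ _ _ E k \o m k.+1)
    (v := m k \o @bd _ _ _ D k)) => s /=.
  rewrite [lin_ext _ _]lin_extU Fbd [bd _]lin_extU linear_sum.
  by apply: eq_bigr => i _; rewrite linearZ /= lin_extU.
have m_aug (c : chain G D 0) : aug (m 0%N c) = aug c.
  apply: (eq_on_basis (u := @aug _ _ _ E \o m 0%N) (v := @aug _ _ _ D)) => s /=.
  by rewrite [lin_ext _ _]lin_extU Faug [RHS]lin_extU.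
by exists (ChainMor m_bd m_aug).
Qed.

End ChainMorphisms.

(** * Towers of covers of the base in which cycles can be filled *)

Section Covers.
Variables (R : realType) (G : comNzRingType) (n : nat).
Variables (X Y : topologicalType) (f : X -> Y).
Implicit Types (U V : set (set Y)).

Definition fill_refines V U : Prop := forall B, V B -> exists C, [/\ U C,
  star V B `<=` C & fills R G n (f @^-1` star V B) (f @^-1` C)].

Hypotheses (Y_paracompact : paracompact Y) (f_continuous : continuous f)
  (f_closed : closed_map f) (f_UV : homologically_UV_map R G n f).

Lemma fill_refinement U : open_cover setT U ->
  exists2 V, open_cover setT V & fill_refines V U.
Proof.
move=> [oU cU].
have /choice[E EP] : forall y, exists E, [/\ open E, E y & exists C, [/\ U C,
    E `<=` C & fills R G n (f @^-1` E) (f @^-1` C)]].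
  move=> y; have [C UC Cy] := cU y I; have [oC _] := oU _ UC.
  have [_ UVy] := f_UV.2 y.
  have [|Q [QC [nQ HQ]]] := UVy (f @^-1` C).
    move=> x fx; apply: open_nbhs_nbhs; split; last by rewrite /= fx.
    by apply: open_comp => // z _; exact: f_continuous.
  (* Closedness of [f] turns the neighborhood [Q] of the fibre into one saturated by [f]: the
     preimage of [C] minus [F] lies in [Q]. *)
  pose F := f @` (~` Q°).
  have clF : closed F by apply/f_closed/open_closedC/open_interior.
  have FQ : f @^-1` (C `&` ~` F) `<=` Q.
    move=> x [_ nF]; apply: contrapT => nQx; apply: nF; exists x => //.
    by move=> /interior_subset.
  exists (C `&` ~` F); split.
  - by apply: openI => //; exact: closed_openC.
  - by split=> // -[x nQx fx]; apply: nQx; exact: nQ.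
  exists C; split=> //.
  exact: fillsS FQ (@subset_refl _ _) (homology_fills HQ).
have [|V cV sV] := @paracompact_star_refinement _ Y_paracompact (range E).
  split=> [_ [y _ <-]|y _]; first by have [] := EP y.
  by exists (E y) => //; have [] := EP y.
exists V => // B /sV[_ [y _ <-] sE]; have [_ _ [C [UC EC fC]]] := EP y.
exists C; split=> //; first exact: subset_trans EC.
by apply: fillsS fC => // x; exact: sE.
Qed.

Lemma fill_refines_sub V U B : fill_refines V U -> V B ->
  exists2 C, U C & B `<=` C.
Proof.
move=> VU VB; have [C [UC sC _]] := VU _ VB; exists C => // y By.
by apply: sC; exists B => //; split=> //; exists y.
Qed.

(** Built downwards: [U] is refined first and the tower continues below the refinement. *)
Lemma fill_tower N U : open_cover setT U -> exists W : nat -> set (set Y),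
  [/\ W N = U, forall k, (k <= N)%N -> open_cover setT (W k) &
    forall k, (k < N)%N -> fill_refines (W k) (W k.+1)].
Proof.
elim: N U => [|N IH] U cU; first by exists (fun=> U).
have [V cV VU] := fill_refinement cU; have [W [WN cW WW]] := IH V cV.
exists (fun k => if (k <= N)%N then W k else U); split=> [|k _|k].
- by rewrite ltnn.
- by case: ifP => // kN; exact: cW.
move=> kN; rewrite -[(k <= N)%N]/(k < N.+1)%N kN; case: ltnP => [/WW //|Nk].
have -> : k = N by lia.
by rewrite WN.
Qed.

End Covers.

(** * Approximation *)

Section Approximation.
Variables (R : realType) (G : comNzRingType) (n : nat).
Variables (X Y : topologicalType) (f : X -> Y) (W : nat -> set (set Y)).
Hypothesis W_tower : forall k, (k < n.+2)%N -> fill_refines R G n f (W k) (W k.+1).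
Variables (V : choiceType) (p : V -> sing_in R [set: X] 0%N).
Local Notation C k := (chain G (sing_in R [set: X]) k).

Let y (v : V) : Y := f (set_val (p v) (vertex R ord0)).

Definition clustered (l : seq V) : Prop :=
  exists2 B, W 0%N B & forall v, v \in l -> B (y v).

(** Requiring [B] to contain the point of some label of [l] anchors the filling; this is what later
    puts the fillings of several lists into a single star. *)
Definition filling k (z : C k) (l : seq V) (d : C k.+1) : Prop :=
  bd d = z /\ exists2 B, W k.+1 B &
    carrier d `<=` f @^-1` B /\ exists2 v, v \in l & B (y v).

(** The filling is chosen once for each list, so that simplexes sharing a face agree on it. The
    value 0 is a default where no filling exists. *)
Fixpoint realize k : seq V -> C k :=
  if k is k'.+1 then
    fun l => xget 0 [set d | filling (lin_ext (realize k') (list_bd G l)) l d]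
  else fun l => if l is v :: _ then gen G (p v) else 0.

Definition realize_chain k : {freeg (seq V) / G} -> C k := lin_ext (@realize k).

HB.instance Definition _ k := GRing.Linear.on (@realize_chain k).

Lemma realize_chainU k l : realize_chain k << l >> = realize k l.
Proof. exact: lin_extU. Qed.

Lemma clusteredS l s : {subset s <= l} -> clustered l -> clustered s.
Proof. by move=> sl [B WB lB]; exists B => // v /sl/lB. Qed.

Lemma tower_sub j k B : (j <= k <= n.+2)%N -> W j B ->
  exists2 B', W k B' & B `<=` B'.
Proof.
move=> /andP[jk kn] WB; elim: k jk kn => [|k IH].
  by rewrite leqn0 => /eqP <- _; exists B.
rewrite leq_eqVlt => /predU1P[<- _|jk kn]; first by exists B.
have [B1 WB1 BB1] := IH jk (ltnW kn).
have [B2 WB2 BB2] := fill_refines_sub (W_tower kn) WB1.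
by exists B2 => //; exact: subset_trans BB2.
Qed.

Lemma point_carrier_in (s : sing_in R [set: X] 0%N) (B : set Y) :
  B (f (set_val s (vertex R ord0))) -> carrier (gen G s) `<=` f @^-1` B.
Proof.
move=> Bs; apply/carrierP; apply: supportedU.
by rewrite /in_carrier scarrier_point => _ ->.
Qed.

Definition realized k (l : seq V) : Prop :=
  exists2 B, W k B & carrier (realize k l) `<=` f @^-1` B /\
    exists2 v, v \in l & B (y v).

(** The realized faces of [l] are carried by members of [W k] meeting a common member, hence by its
    star; their alternating sum is a cycle of degree at most [n] and can be filled one level
    higher. *)
Lemma realizeP k l : (k <= n.+1)%N -> clustered l -> size l = k.+1 ->
  realized k l /\
  match k return C k -> Prop with
  | 0 => fun c => aug c = 1
  | k'.+1 => fun c => bd c = realize_chain k' (list_bd G l)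
  end (realize k l).
Proof.
elim: k l => [|k IH] l kn.
  case: l => // v [|//] [B WB /(_ v (mem_head _ _)) Bv] _ /=; split.
    exists B => //; split; first exact: point_carrier_in.
    by exists v => //; rewrite mem_head.
  exact: augU.
move=> cl zl; set z := realize_chain k (list_bd G l).
suff : filling z l (realize k.+1 l) by case=> bd_z [B WB cB]; split=> //; exists B.
suff ex_d : exists d, filling z l d by exact: (xgetPex 0 ex_d).
have [B WB lB] := cl.
have [B' WB' BB'] : exists2 B', W k B' & B `<=` B'.
  by apply: tower_sub WB; rewrite /= ltnW // ltnW.
have [C' [WC sC fC]] := W_tower (ltnW kn) WB'.
have faces t : {subset t <= l} /\ (size t).+1 = size l ->
    clustered t /\ size t = k.+1.
  by move=> [tl zt]; split; [exact: clusteredS cl | lia].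
have zB : carrier z `<=` f @^-1` star (W k) B'.
  apply/carrierP; apply: linear_image_supported
    (@list_bd_supported G V l) => t tl /=.
  have [ct zt] := faces _ tl; rewrite realize_chainU; apply/carrierP.
  have [[D WD [tD [v vt Dv]]] _] := IH t (ltnW kn) ct zt.
  apply: subset_trans tD _ => x Dx; exists D => //; split=> //.
  by exists (y v); split=> //; apply/BB'/lB; exact: tl.1.
have cz : is_cycle z.
  (* In degree 0 the chain is a difference of two points, of augmentation 0; in higher degrees the
     boundary vanishes by [list_bdK]. *)
  case: (k) @z zB zl IH kn faces {WB' WC sC fC}
    => [|k'] z zB zl IH kn faces; apply/eqP.
    case: l zl @z {cl lB zB faces} => [|u [|v [|]]] //= _.
    rewrite [lcons v 0]linear0 subr0 lconsU linearB /= !realize_chainU linearB /=.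
    by rewrite !augU subrr.
  have -> : bd z = realize_chain k' (lbd (list_bd G l)).
    apply: (@eq_supported _ _ _ (@bd _ _ _ _ k' \o realize_chain k'.+1)
      (realize_chain k' \o @lbd G V) _ _ _ (@list_bd_supported G V l)) => t tl /=.
    have [ct zt] := faces _ tl; rewrite realize_chainU lbdU.
    by have [_ ->] := IH t (ltnW kn) ct zt.
  by rewrite list_bdK linear0.
have [d bd_d dC] := fC k z kn zB cz.
have [v vl] : exists v, v \in l.
  by case: (l) zl => // v l' _; exists v; exact: mem_head.
exists d; split=> //; exists C' => //; split=> //; exists v => //.
apply: sC; exists B'; last by apply/BB'/lB.
by split=> //; exists (y v); split; apply/BB'/lB.
Qed.

Variables (le : rel V).
Hypotheses (le_anti : antisymmetric le) (le_trans : transitive le)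
  (le_total : total le).
Variables (T : topologicalType) (c : T -> V) (D : simp_family R T).
Hypothesis D_clustered : forall k (s : D k), exists L : seq V,
  [/\ (size L <= n.+2)%N, forall x, scarrier (set_val s) x -> c x \in L &
    clustered L].

Let labels k (s : D k) : seq V := [seq c x | x <- vertices (set_val s)].

Definition approximation k (s : D k) : C k :=
  realize_chain k (sort_chain G le (labels s)).

Lemma labels_sub k (s : D k) (L : seq V) :
  (forall x, scarrier (set_val s) x -> c x \in L) -> {subset labels s <= L}.
Proof. by move=> sL v /mapP[x /vertices_carrier/sL xL ->]. Qed.

Lemma size_labels k (s : D k) : size (labels s) = k.+1.
Proof. by rewrite size_map size_vertices. Qed.

Lemma approximation0 (s : D 0%N) :
  approximation s = gen G (p (c (set_val s (vertex R ord0)))).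
Proof.
rewrite /approximation /labels /vertices enum_ordSl enum_ord0 /=.
by rewrite wedgeU /= realize_chainU.
Qed.

Lemma approximation_bd k (s : D k.+1) : bd (approximation s) =
  \sum_(i < k.+2) (-1) ^+ i *: approximation (dface i s).
Proof.
have -> : \sum_(i < k.+2) (-1) ^+ i *: approximation (dface i s) =
    realize_chain k (lbd (sort_chain G le (labels s))).
  rewrite lbd_sort_chain // list_bd_vertices !linear_sum; apply: eq_bigr => i _.
  by rewrite !linearZ /= lsortU.
have [L [zL sL cL]] := D_clustered s.
(* For [k > n] the [k.+2] labels come from a list of at most [n.+2], so both sides vanish: no cycle
   of degree above [n] has to be filled. *)
have [kn|nk] := leqP k n; last first.
  have sL' : (size L < size (labels s))%N.
    by rewrite size_labels; apply: leq_ltn_trans zL _; rewrite !ltnS.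
  have l0 : sort_chain G le (labels s) = 0.
    by apply: (sort_chain_eq0 _ _ _ _ (labels_sub sL)).
  by rewrite /approximation l0 !linear0.
apply: (@eq_supported _ _ _ (@bd _ _ _ _ k \o realize_chain k.+1)
  (realize_chain k \o @lbd G V) _ _ _
  (@sort_chain_supported G V le le_anti le_trans le_total (labels s))).
move=> t [_ tl zt] /=; rewrite realize_chainU lbdU.
have [||_ //] := @realizeP k.+1 t kn; last by rewrite zt size_labels.
by apply: clusteredS cL => v /tl; exact: labels_sub.
Qed.

(** Each realized list lies over a member of some level up to [n.+1] containing the point of a
    label; enlarged to level [n.+1], this member meets [B']. *)
Lemma approximation_carrier k (s : D k) (B B' : set Y) :
  W 0%N B -> W n.+1 B' -> B `<=` B' ->
  (forall x, scarrier (set_val s) x -> B (y (c x))) ->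
  carrier (approximation s) `<=` f @^-1` star (W n.+1) B'.
Proof.
move=> WB WB' BB' sB; have [L [zL sL cL]] := D_clustered s.
have lB v : v \in labels s -> B (y v).
  by move=> /mapP[x /vertices_carrier/sB xB ->].
have [kn|nk] := leqP k n.+1; last first.
  have sL' : (size L < size (labels s))%N.
    by rewrite size_labels; apply: leq_ltn_trans zL _; rewrite ltnS.
  have l0 : sort_chain G le (labels s) = 0.
    by apply: (sort_chain_eq0 _ _ _ _ (labels_sub sL)).
  by rewrite /approximation l0 !linear0 => x [t]; rewrite /= dom0.
apply/carrierP; apply: linear_image_supported
  (@sort_chain_supported G V le le_anti le_trans le_total (labels s)).
move=> t [_ tl zt] /=; rewrite realize_chainU; apply/carrierP.
have [||[E WE [tE [v vt Ev]]] _] := @realizeP k t kn; last first.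
- have [|E' WE' EE'] := @tower_sub k n.+1 E _ WE; first by rewrite kn leqnSn.
  apply: subset_trans tE _ => x Ex; exists E'; last exact: EE'.
  by split=> //; exists (y v); split; [exact: EE' | exact/BB'/lB/tl].
- by rewrite zt size_labels.
by exists B => // v /tl/lB.
Qed.

End Approximation.

(** * Labelling a neighborhood of [A] and assembling the morphism *)

Lemma seq_argmax (R : realDomainType) (T : eqType) (r : T -> R) (x : T) (s : seq T) :
  exists2 a, a \in x :: s & forall b, b \in x :: s -> r b <= r a.
Proof.
elim: s x => [x|z s IH x].
  by exists x; rewrite ?mem_head // => b; rewrite inE => /eqP->.
have [a as_ amax] := IH z; have [xa|ax] := leP (r x) (r a).
  by exists a => [|b]; rewrite inE ?as_ ?orbT // => /predU1P[->|/amax].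
exists x => [|b]; first exact: mem_head.
by rewrite inE => /predU1P[->//|/amax ba]; exact: le_trans ba (ltW ax).
Qed.

Theorem proposition3p6 (R : realType) (G : comNzRingType) (n : nat)
    (X Y : topologicalType) (f : X -> Y)
    (X_paracompact : paracompact X) (Y_paracompact : paracompact Y)
    (f_continuous : continuous f) (f_closed : closed_map f)
    (f_UV : homologically_UV_map R G n f) :
  forall U : set (set Y), open_cover setT U ->
  exists V : set (set Y), open_cover setT V /\
  forall (M : metricType R) (A : set M), dim_le M n.+1 -> closed A ->
  forall phi : chain_mor G (sing_in R A) (sing_in R [set: X]),
    continuous_mor phi -> correct_mor phi -> small_mor (preimage_cover f V) phi ->
  exists (W : set M) (alpha : set (set M))
    (Phi : chain_mor G (sing_small R W alpha) (sing_in R [set: X]))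
    (AW : A `<=` W),
    [/\ open W, open_cover W alpha, correct_mor Phi &
        close_mor (preimage_cover f U)
          (restrict_mor Phi (sing_small_sub (alpha := alpha) AW))
          (restrict_mor phi (sing_small_in (alpha := alpha)))].
Proof.
move=> U cU; have [W [WU cW W_tower]] :=
  fill_tower Y_paracompact f_continuous f_closed f_UV n.+2 cU.
exists (W 0%N); split; first exact: cW.
move=> M A dimM clA phi phi_cont phi_corr phi_small.
(* An empty [A] is treated apart, with empty [W]; otherwise a point of [A] serves as default
   label. *)
have [A0|/set0P[a00 Aa0]] := eqVneq A set0.
  have noD k (s : sing_small R (@set0 M) set0 k) : False.
    by have [_ [B []]] := set_valP s.
  have [||Phi _] := @chain_mor_basis R G M X (sing_small R set0 set0)
    (sing_in R [set: X]) (fun k _ => 0).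
  - by move=> k s; case: (noD _ s).
  - by move=> s; case: (noD _ s).
  have AW : A `<=` set0 by rewrite A0.
  exists set0, set0, Phi, AW; split.
  - exact: open0.
  - by split.
  - by move=> s; case: (noD _ s).
  - by move=> k s; have [_ [B []]] := set_valP s.
pose a0 : A := SigSub (mem_set Aa0).
have /choice[p pP] := fun a : A => phi_corr (point_in R a).
pose h (a : A) : Y := f (set_val (p a) (vertex R ord0)).
have carrier_p a : carrier (gen G (p a)) = [set set_val (p a) (vertex R ord0)].
  rewrite -scarrier_point; apply/seteqP; split=> [x [s]|x px].
    by rewrite /= domU1 inE => /eqP->.
  by exists (p a) => //=; rewrite domU1 mem_head.
(* Continuity of [phi] keeps the points [h a'], for [a'] within [r a] of [a], in one member of
   [W 0]. *)
have /choice[r rP] : forall a : A, exists r : R, 0 < r /\ exists2 B, W 0%N B &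
    forall a' : A, ball (set_val a) r (set_val a') -> B (h a').
  move=> a; have [oW0 cW0] := cW 0%N (leq0n _).
  have [B WB Ba] := cW0 (h a) I.
  have : set_nbhs (carrier (phi 0%N (gen G (point_in R a)))) (f @^-1` B).
    move=> x; rewrite pP carrier_p => ->; apply: open_nbhs_nbhs; split=> //.
    by apply: open_comp; [move=> ? _; exact: f_continuous | have [] := oW0 _ WB].
  move=> /phi_cont[_ [[N oN <-] Na] NB].
  have /nbhs_ballP[e /= e0 eN] : nbhs (set_val a) N by apply: open_nbhs_nbhs.
  exists e; split=> //; exists B => // a' /eN/NB /=.
  by rewrite pP carrier_p; apply.
(* Quarter radii let two balls with a common point fit into the full ball of the larger radius.
   [None] labels the complement of [A]. *)
pose O (i : option A) : set M :=
  if i is Some a then (ball (set_val a) (r a / 4))° else ~` A.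
have r40 a : 0 < r a / 4 by rewrite divr_gt0 //; have [] := rP a.
have [|x|alpha0 [c0 [[oalpha calpha] alphaP]]] := @dim_assignment R M _ O n.+1 dimM.
- by case=> [a|]; [exact: open_interior | exact: closed_openC].
- have [Ax|nAx] := pselect (A x); last by exists None.
  exists (Some (SigSub (mem_set Ax))) => /=; apply: nbhsx_ballx.
  exact: r40.
pose alpha := [set B | alpha0 B /\ B `&` A !=set0].
pose W1 : set M := \bigcup_(B in alpha) B.
have AW : A `<=` W1.
  move=> x Ax; have [B aB Bx] := calpha x I.
  by exists B => //; split=> //; exists x.
pose c (x : M) : A := odflt a0 (c0 x).
have alpha_clustered B : alpha B -> exists L : seq A, [/\ (size L <= n.+2)%N,
    forall x, B x -> c x \in L & exists2 B', W 0%N B' &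
    (forall v, v \in L -> B' (h v)) /\ forall a : A, B (set_val a) -> B' (h a)].
  move=> [aB [b [Bb Ab]]]; have [L0 [zL0 cL0 LB0]] := alphaP _ aB.
  pose L := [seq odflt a0 i | i <- L0].
  have cL x : B x -> c x \in L by move=> /cL0 xL; exact: map_f.
  have LB v z : v \in L -> B z -> ball (set_val v) (r v / 4) z.
    move=> /mapP[[i|] iL ->] Bz /=; last by have /(_ _ Bb) := LB0 _ iL.
    by have /(_ _ Bz)/interior_subset := LB0 _ iL.
  exists L; split=> //; first by rewrite size_map.
  (* The label of largest radius has all the other labels, and the points of [A] in [B], within
     distance [r v]. *)
  have [v vL vmax] : exists2 v, v \in L & forall w, w \in L -> r w <= r v.
    by have := cL _ Bb; case: (L) => // v L' _; exact: seq_argmax.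
  have [r0 [B' WB' vB']] := rP v; exists B' => //; split=> [w wL|a Ba].
    have vw := ball_triangle (LB _ _ vL Bb) (ball_sym (LB _ _ wL Bb)).
    apply: vB'; apply: le_ball vw.
    by have := vmax _ wL; lra.
  by apply: vB'; apply: le_ball (LB _ _ vL Ba); lra.
have [le [le_anti le_trans le_total _]] := well_ordering A.
have D_clustered k (s : sing_small R W1 alpha k) : exists L : seq A,
    [/\ (size L <= n.+2)%N, forall x, scarrier (set_val s) x -> c x \in L &
    clustered f W p L].
  have [_ [B aB sB]] := set_valP s.
  have [L [zL cL [B' WB' [LB' _]]]] := alpha_clustered _ aB.
  by exists L; split=> // [x /sB/cL //|]; exists B'.
have [||Phi PhiE] := chain_mor_basis
  (F := @approximation R G X Y f W A p le M c (sing_small R W1 alpha)).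
- exact: (approximation_bd W_tower le_anti le_trans le_total D_clustered).
- by move=> s; rewrite approximation0 augU.
exists W1, alpha, Phi, AW; split.
- by apply: bigcup_open => B [aB _]; have [] := oalpha _ aB.
- split=> // B aB; split; first by have [] := oalpha _ aB.1.
  by move=> x Bx; exists B.
- by move=> s; rewrite PhiE approximation0; eexists.
move=> k s; have [sA [B0 aB0 sB0]] := set_valP s.
have [L [zL cL [B WB [LB AB]]]] := alpha_clustered _ aB0.
have [|B' WB' BB'] := tower_sub W_tower (j := 0) (k := n.+1) _ WB.
  by rewrite leqnSn.
(* The last level of the tower, [n.+2], is spent on absorbing the star of [B'], which will contain
   the images under both morphisms. *)
have [C [WC sC _]] := W_tower _ (ltnSn n.+1) _ WB'.
exists (f @^-1` C); first by exists C => //; rewrite -WU.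
move=> j t ts.
have {}sC : f @^-1` star (W n.+1) B' `<=` f @^-1` C by move=> x /sC.
rewrite subUset; split.
  rewrite /= [lin_ext _ _]lin_extU PhiE; apply: subset_trans sC.
  apply: (approximation_carrier W_tower) WB WB' BB' _ => //= x tx.
  by apply/LB/cL/sB0; exact: face_carrier ts _ tx.
rewrite /= [lin_ext _ _]lin_extU.
pose s' := sub_simp (@sing_small_in R M A alpha) s.
have [_ [E WE <-] sE] := phi_small k s'.
have tE : carrier (phi j (gen G (sub_simp (@sing_small_in R M A alpha) t)))
  `<=` f @^-1` E by apply: sE.
apply: subset_trans tE _; apply: subset_trans sC => x Ex.
(* The first vertex [a] of [s] links the two estimates: [h a] lies in [E] by smallness of [phi], and
   in [B] because [a] is a point of [B0]. *)
have Av : A (set_val s (vertex R ord0)) by apply: sA; exists (vertex R ord0).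
pose a : A := SigSub (mem_set Av).
have Ea : E (h a).
  have : carrier (phi 0%N (gen G (point_in R a))) `<=` f @^-1` E.
    apply: sE; exists (fun=> ord0); first by move=> i i'; rewrite !ord1 ltnn.
    by rewrite [RHS]sing0_point /= affine_vertex.
  by rewrite pP carrier_p; apply.
have [|E' WE' EE'] := tower_sub W_tower (j := 0) (k := n.+1) _ WE.
  by rewrite leqnSn.
exists E'; last exact: EE'.
split=> //; exists (h a); split; first exact: EE'.
by apply/BB'/AB/sB0; exists (vertex R ord0).
Qed.
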